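(* Let $K$ be a finite extension of $\mathbb{Q}_p$ of degree $h$, with residue field $\mathbb{F}_q$. There exists a family $(\mathcal{S}_{\alpha})_{\alpha}$ of elements of $R=\operatorname{Rep}_E(\operatorname{GL}_2(\mathbb{F}_q))\otimes_{\mathbb{Z}}\mathbb{R}$, indexed by the central characters $\alpha$ of $\operatorname{GL}_2(\mathbb{F}_q)$ (characters of its center with values in $\mathbb{F}_q^*$), such that for any representation $W$ of $\operatorname{GL}_2(\mathbb{F}_q)$ that has a central character, and for any representation $U$ of $\operatorname{GL}_2(\mathbb{F}_q)$ that is the reduction in characteristic $p$ of an irreducible algebraic representation of $\operatorname{Res}_{K/\mathbb{Q}_p}\operatorname{GL}_2$, the class $[V]$ in $R$ of the representation $V=W\otimes U$ satisfies $$[V]=(\dim V)\,\mathcal{S}_{\alpha(V)}+O\big((\dim U)^{1-1/h}\big),$$ where $\alpha(V)$ denotes the central character of $V$, and where the constant implied in $O$ (with respect to any fixed norm on the finite-dimensional real vector space $R$) may depend on $K$ and $W$ but not on $U$.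
   Context: $p$ is a prime, $q=p^f$ is the cardinality of the residue field of $K$, and $E$ is an algebraic closure of $\mathbb{F}_q$, with a fixed embedding $\mathbb{F}_q\subset E$. Representations of $\operatorname{GL}_2(\mathbb{F}_q)$ are finite-dimensional over $E$. $\operatorname{Rep}_E(\operatorname{GL}_2(\mathbb{F}_q))$ is the Grothendieck group of these representations, and $[V]$ denotes the class of $V$. A representation has a central character if the center of $\operatorname{GL}_2(\mathbb{F}_q)$ acts on it by scalars through a single character. The irreducible algebraic representations of $\operatorname{Res}_{K/\mathbb{Q}_p}\operatorname{GL}_2$ (over $\overline{\mathbb{Q}}_p$) are the $V_{n,m}=\bigotimes_{\tau\in \operatorname{Hom}(K,\overline{\mathbb{Q}}_p)}(\operatorname{Symm}^{n_\tau}W_\tau\otimes\det_\tau^{m_\tau})$ with $n_\tau\in\mathbb{Z}_{\ge0}$, $m_\tau\in\mathbb{Z}$. Here $W_\tau$ is the standard 2-dimensional representation of $\operatorname{GL}_2$ given by $\tau:K\to\overline{\mathbb{Q}}_p$, and $\det_\tau=\det W_\tau$. The reduction in characteristic $p$ of $V_{n,m}$ is the reduction of a stable lattice (stable under $\operatorname{GL}_2(\mathcal{O}_K)$). Its semisimplification is independent of the lattice and is a representation of $\operatorname{GL}_2(\mathbb{F}_q)$, which always has a central character. Only its class in the Grothendieck group matters. *)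

(* Defs.v *)
From HB Require Import structures.
From mathcomp Require Import all_boot all_order all_fingroup all_algebra.
From mathcomp Require Import all_solvable all_field all_character.
From mathcomp Require Import generic_quotient ring_quotient.
From mathcomp Require Import boolp reals exp.
From mathcomp Require Import freeg.

Set Implicit Arguments.
Unset Strict Implicit.
Unset Printing Implicit Defensive.

Import Order.TTheory GRing.Theory Num.Theory.

Local Open Scope ring_scope.

Section Grothendieck.
Variables (R : realType) (E : fieldType) (gT : finGroupType) (G : {group gT}).

Definition repr_obj : Type := {n : nat & mx_representation E G n}.

(* Modules are spaces of row vectors on which [G] acts from the right, so the
   maps of the sequence 0 -> V1 -> V -> V2 -> 0 are v |-> v *m f and
   v |-> v *m g. *)
Definition short_exact n1 n n2 (V1 : mx_representation E G n1)
    (V : mx_representation E G n) (V2 : mx_representation E G n2) : Prop :=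
  exists f : 'M[E]_(n1, n), exists g : 'M[E]_(n, n2),
    [/\ forall x, x \in G -> V1 x *m f = f *m V x,
        forall x, x \in G -> V x *m g = g *m V2 x,
        row_free f, row_full g & (f == kermx g)%MS].

Definition free_class n (V : mx_representation E G n) :
    {freeg {classic repr_obj} / R} :=
  << (existT _ n V : {classic repr_obj}) >>.

Definition relator (x : {freeg {classic repr_obj} / R}) : Prop :=
  exists n1 n n2, exists V1 : mx_representation E G n1,
  exists V : mx_representation E G n, exists V2 : mx_representation E G n2,
    short_exact V1 V V2 /\ x = free_class V - free_class V1 - free_class V2.

Definition relations (x : {freeg {classic repr_obj} / R}) : bool :=
  `[< exists s : seq (R * {freeg {classic repr_obj} / R}),
        (forall y, y \in s -> relator y.2) /\
        x = \sum_(y <- s) y.1 *: y.2 >].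

Lemma relations_submod_closed : submod_closed relations.
Proof.
split; first by apply/asboolP; exists [::]; rewrite big_nil.
move=> a x y /asboolP[s [hs ->]] /asboolP[t [ht ->]]; apply/asboolP.
exists ([seq (a * z.1, z.2) | z <- s] ++ t); split.
  move=> z; rewrite mem_cat => /orP[/mapP[z' /hs h ->] //|]; exact: ht.
rewrite big_cat big_map scaler_sumr /=; congr (_ + _).
by apply: eq_bigr => z _; rewrite scalerA.
Qed.

HB.instance Definition _ :=
  GRing.isSubmodClosed.Build R {freeg {classic repr_obj} / R} relations
    relations_submod_closed.

Definition relations_zmod : zmodClosed {freeg {classic repr_obj} / R} :=
  GRing.ZmodClosed.clone _ relations _.

(* Rep_E(G) is the free abelian group on the representations modulo the
   relations [V] = [V1] + [V2]; since - (x) R is right exact,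
   Rep_E(G) (x) R is the free real vector space on the representations modulo
   the subspace spanned by the same relations. *)
Definition rep_group : Type := Quotient.quot relations_zmod.

HB.instance Definition _ := GRing.Zmodule.on rep_group.
HB.instance Definition _ := EqQuotient.on rep_group.

Definition rep_group_pi (x : {freeg {classic repr_obj} / R}) : rep_group :=
  \pi_(rep_group)%qT x.

Lemma rep_group_piD x y :
  rep_group_pi (x + y) = rep_group_pi x + rep_group_pi y.
Proof. exact: (raddfD \pi_(Quotient.quot relations_zmod)%qT). Qed.

Lemma rep_group_pi_eq x y :
  rep_group_pi x = rep_group_pi y <-> relations (x - y).
Proof.
have -> : relations (x - y) = (rep_group_pi x == rep_group_pi y).
  exact: (Quotient.idealrBE relations_zmod).
by split=> /eqP.
Qed.

Lemma rep_group_reprK (x : rep_group) : rep_group_pi (repr x) = x.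
Proof. exact: reprK. Qed.

Definition rep_group_scale (a : R) (x : rep_group) : rep_group :=
  rep_group_pi (a *: repr x).

Lemma rep_group_scale_pi a x :
  rep_group_scale a (rep_group_pi x) = rep_group_pi (a *: x).
Proof.
apply/rep_group_pi_eq; rewrite -scalerBr -[_ *: _]addr0.
have [rel0 relP] := relations_submod_closed.
by apply: relP => //; apply/rep_group_pi_eq/rep_group_reprK.
Qed.

Lemma rep_group_scaleA a b x :
  rep_group_scale a (rep_group_scale b x) = rep_group_scale (a * b) x.
Proof. by rewrite rep_group_scale_pi scalerA. Qed.

Lemma rep_group_scale1 : left_id 1 rep_group_scale.
Proof. by move=> x; rewrite /rep_group_scale scale1r rep_group_reprK. Qed.

Lemma rep_group_scaleDr : right_distributive rep_group_scale +%R.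
Proof.
move=> a x y; rewrite -[x]rep_group_reprK -[y]rep_group_reprK -rep_group_piD.
by rewrite !rep_group_scale_pi scalerDr rep_group_piD.
Qed.

Lemma rep_group_scaleDl x :
  {morph rep_group_scale^~ x : a b / a + b}.
Proof. by move=> a b; rewrite -rep_group_piD -scalerDl. Qed.

HB.instance Definition _ := GRing.Zmodule_isLmodule.Build R rep_group
  rep_group_scaleA rep_group_scale1 rep_group_scaleDr rep_group_scaleDl.

Definition rep_class n (V : mx_representation E G n) : rep_group :=
  rep_group_pi (free_class V).

Lemma rep_class_exact n1 n n2 (V1 : mx_representation E G n1)
    (V : mx_representation E G n) (V2 : mx_representation E G n2) :
  short_exact V1 V V2 -> rep_class V = rep_class V1 + rep_class V2.
Proof.
move=> ex; rewrite /rep_class -rep_group_piD; apply/rep_group_pi_eq.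
apply/asboolP; exists [:: (1, free_class V - free_class V1 - free_class V2)].
split; last by rewrite big_seq1 scale1r opprD addrA.
by move=> y; rewrite inE => /eqP ->; exists n1, n, n2, V1, V, V2.
Qed.

End Grothendieck.

Definition is_norm (R : realType) (V : lmodType R) (N : V -> R) : Prop :=
  [/\ forall x, N x = 0 -> x = 0,
      forall a x, N (a *: x) = `|a| * N x &
      forall x y, N (x + y) <= N x + N y].

Definition central_char (F : finFieldType) : Type :=
  {a : {ffun subg_of 'Z('GL_2[F]) -> {unit F}} |
     morphic [set: subg_of 'Z('GL_2[F])] a}.

(* [j] is the fixed embedding of F_q in its algebraic closure. *)
Definition has_central_char (F : finFieldType) (E : fieldType)
    (j : {rmorphism F -> E}) n (V : mx_representation E 'GL_2[F] n)
    (a : central_char F) : Prop :=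
  forall z : subg_of 'Z('GL_2[F]), V (sgval z) = (j (val (val a z)))%:M.

Definition padic_abs (R : realType) (p : nat) (x : rat) : R :=
  if x == 0 then 0
  else p%:R ^ ((logn p `|denq x|%N)%:Z - (logn p `|numq x|%N)%:Z).

(* [Qp], with the absolute value [v], is the completion of the rational numbers
   for the p-adic absolute value. *)
Record is_padic_field (R : realType) (p : nat) (Qp : fieldType)
    (v : Qp -> R) : Prop := {
  padic_eq0 : forall x, v x = 0 -> x = 0;
  padic_mul : forall x y, v (x * y) = v x * v y;
  padic_add : forall x y, v (x + y) <= Num.max (v x) (v y);
  padic_rat : forall a : rat, v (ratr a) = padic_abs R p a;
  padic_dense : forall x (e : R), 0 < e -> exists a : rat, v (x - ratr a) < e;
  padic_complete : forall u : nat -> Qp,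
    (forall e : R, 0 < e -> exists N : nat, forall m n : nat,
       (N <= m)%N -> (N <= n)%N -> v (u m - u n) < e) ->
    exists l, forall e : R, 0 < e -> exists N : nat, forall n : nat,
      (N <= n)%N -> v (u n - l) < e }.

(* The ring of integers of an algebraic extension [i : Qp -> L]. *)
Definition int_ring (R : realType) (Qp : fieldType) (v : Qp -> R)
    (L : fieldType) (i : Qp -> L) (x : L) : Prop :=
  exists P : {poly Qp},
    [/\ P \is monic, forall k, v P`_k <= 1 & root (map_poly i P) x].

(* [r] restricts to a surjective ring morphism from the local ring [O] to [k]
   whose kernel is the set of non-units of [O]; its values outside [O] are
   irrelevant. *)
Record is_residue_map (L : fieldType) (O : L -> Prop) (k : fieldType)
    (r : L -> k) : Prop := {
  residue1 : r 1 = 1;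
  residueD : forall x y, O x -> O y -> r (x + y) = r x + r y;
  residueM : forall x y, O x -> O y -> r (x * y) = r x * r y;
  residue_surj : forall y, exists x, O x /\ r x = y;
  residue_ker : forall x, O x -> (r x = 0 <-> x = 0 \/ ~ O x^-1) }.

(* [tau] lists the elements of Hom_{Qp}(K, L), each exactly once. *)
Definition enumerates_embeddings (Qp : fieldType) (K : fieldExtType Qp)
    (L : fieldType) (iota : {rmorphism Qp -> L}) (J : finType)
    (tau : J -> {rmorphism K -> L}) : Prop :=
  [/\ forall s a, tau s a%:A = iota a,
      forall s t, tau s =1 tau t -> s = t &
      forall f : {rmorphism K -> L}, (forall a, f a%:A = iota a) ->
        exists s, tau s =1 f].

(* Matrix of Symm^n g in the basis X^(n - i) Y^i, 0 <= i <= n, with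
   X |-> g 0 0 X + g 0 1 Y and Y |-> g 1 0 X + g 1 1 Y; monomials are
   dehomogenized by X := 1 and Y := 'X. *)
Definition symm_mx (L : fieldType) (n : nat) (g : 'M[L]_2) : 'M[L]_n.+1 :=
  \matrix_(i, k) (((g 0 0)%:P + (g 0 1)%:P * 'X) ^+ (n - i) *
                  ((g 1 0)%:P + (g 1 1)%:P * 'X) ^+ i)`_k.

Section AlgebraicRepresentations.
Variables (Qp : fieldType) (K : fieldExtType Qp) (L : fieldType).
Variables (J : finType) (tau : J -> {rmorphism K -> L}).
Variables (n : J -> nat) (m : J -> int).

(* Indices of the basis of pure tensors of the product of the Symm^(n s). *)
Definition alg_basis : finType := {dffun forall s : J, 'I_(n s).+1}.

Definition alg_repr (g : 'M[K]_2) : 'M[L]_#|alg_basis| :=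
  \matrix_(a, b) \prod_(s : J)
    (symm_mx (n s) (map_mx (tau s) g)
       ((enum_val a : alg_basis) s) ((enum_val b : alg_basis) s)
     * \det (map_mx (tau s) g) ^ m s).

End AlgebraicRepresentations.

Section Reduction.
Variables (K : fieldType) (OK : K -> Prop) (F : finFieldType) (redK : K -> F).
Variables (L : fieldType) (OL : L -> Prop) (E : fieldType) (redE : L -> E).

Definition GL2_int (g : 'M[K]_2) : Prop :=
  [/\ forall i k, OK (g i k), \det g != 0 & OK (\det g)^-1].

(* The rows of [P] are a basis of the lattice, so the matrices of the action on
   the lattice are those of the conjugates of [rho] by [P]. *)
Definition stable_lattice d (rho : 'M[K]_2 -> 'M[L]_d) (P : 'M[L]_d) : Prop :=
  P \in unitmx /\
  forall g, GL2_int g -> forall i k, OL ((P *m rho g *m invmx P) i k).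

Definition lattice_reduction d (rho : 'M[K]_2 -> 'M[L]_d) (P : 'M[L]_d)
    (g : 'M[K]_2) : 'M[E]_d :=
  map_mx redE (P *m rho g *m invmx P).

(* In the basis given by the rows of [A], the vectors of index at most c for
   [blk] span a subrepresentation of [rho] for every c; up to the change of
   basis [B], [U] is the graded representation of this filtration, and it is
   semisimple. *)
Definition is_semisimplification d (rho : 'M[K]_2 -> 'M[E]_d)
    (U : mx_representation E 'GL_2[F] d) : Prop :=
  inhabited (mxsemisimple U 1%:M) /\
  exists A : 'M[E]_d, exists B : 'M[E]_d, exists blk : 'I_d -> nat,
    [/\ A \in unitmx, B \in unitmx &
        forall (g : 'M[K]_2) (gF : {'GL_2[F]}),
          GL2_int g -> GLval gF = map_mx redK g ->
          forall i k,
            ((blk i < blk k)%N -> (A *m rho g *m invmx A) i k = 0) /\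
            (B *m U gF *m invmx B) i k =
              if blk i == blk k then (A *m rho g *m invmx A) i k else 0].

(* Only the class of the reduction is well defined, hence the last equality. *)
Definition is_reduction (R : realType) d (rho : 'M[K]_2 -> 'M[L]_d)
    u (U : mx_representation E 'GL_2[F] u) : Prop :=
  exists P : 'M[L]_d, exists U0 : mx_representation E 'GL_2[F] d,
    [/\ stable_lattice rho P,
        is_semisimplification (lattice_reduction rho P) U0 &
        rep_class R U = rep_class R U0].

End Reduction.

(* Main.v *)
(* The error term is in fact bounded.  Let N be the order of GL_2(F_q), let Sym^N
   be the N-th symmetric power of the standard representation over E, and let
   chi be a character of the N-th roots of unity of E.  If g has eigenvalues a
   and b, then the sum of chi over the eigenvalues of Sym^N(g) is N + 1 when
   chi(a) = chi(b), and 1 otherwise.  In the first case chi is also constant on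
   the eigenvalues at g of any representation with a central character: if o is
   the order of g modulo the center, these have the same o-th power, and b/a
   generates the o-th roots of unity.  Hence
   S = ([Sym^N (x) V] - [V]) / (N dim V) depends only on the central character
   of V.  On the other hand, if chi(a) <> chi(b), then the sum of chi over the
   eigenvalues of Symm^n(g) depends only on n modulo N, so that
   [W (x) U] - dim (W (x) U) S takes finitely many values when n and m vary.
   Passing from eigenvalues to classes is the Brauer-Nesbitt theorem, which also
   makes the choice of the lattice irrelevant. *)

(* Write e for ([Sym^N] - 1) / N. At a pair (g, chi) its value is 1 if chi(a) = chi(b) and 0
   otherwise, so e is an idempotent of the ring R, S is [V] e / dim V, and the error is [V] (1 - e).
   Since N is the order of the group, all eigenvalues of all representations are N-th roots of
   unity; hence the same N serves as degree of the symmetric power and as period in n and m.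

   The chi range over all characters, not only the faithful ones: at a fixed g, their sums together
   recover the multiset of eigenvalues by Fourier inversion, hence the characteristic polynomial. In
   characteristic p this is still one step away from the class, because traces see multiplicities
   only modulo p.

   The reduction U mixes several embeddings of F_q in E, whereas S is built with the single
   embedding [j]. The condition chi(a) = chi(b) must therefore be independent of the embedding: it
   says that chi is trivial on the o-th roots of unity, and o is defined by g alone. *)
Require Import Defs.
From HB Require Import structures.
From mathcomp Require Import all_boot all_order all_fingroup all_algebra.
From mathcomp Require Import all_solvable all_field all_character.
From mathcomp Require Import boolp reals exp.
From mathcomp Require Import freeg.

Set Implicit Arguments.
Unset Strict Implicit.
Unset Printing Implicit Defensive.

Import Order.TTheory GRing.Theory Num.Theory.

Local Open Scope ring_scope.

(** * Block triangular matrices *)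

(* A permutation s contributes to either determinant only if blk (s i) <= blk i
   for all i, and then equality holds since both sides have the same sum. *)
Lemma det_block_trig (R : comNzRingType) n (M : 'M[R]_n) (blk : 'I_n -> nat) :
  (forall i k, (blk i < blk k)%N -> M i k = 0) ->
  \det M = \det (\matrix_(i, k) if blk i == blk k then M i k else 0).
Proof.
move=> M0; apply: eq_bigr => s _; congr (_ * _).
have [s_blk | ] := boolP [forall i, blk i == blk (s i)].
  by apply: eq_bigr => i _; rewrite mxE (forallP s_blk).
rewrite negb_forall => /existsP[i0 nblk].
have [i lt_i]: exists i, (blk i < blk (s i))%N.
  apply/existsP; apply: contraR nblk; rewrite negb_exists => /forallP le_blk.
  have le_s i : (blk (s i) <= blk i)%N by rewrite leqNgt le_blk.
  have sum_eq : \sum_i blk (s i) = \sum_i blk i.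
    by rewrite [RHS](reindex_inj (@perm_inj _ s)).
  have [_] := leqif_sum (fun i (_ : true) => leqif_eq (le_s i)).
  by rewrite sum_eq eqxx => /esym/forallP/(_ i0); rewrite eq_sym.
rewrite (bigD1 i) //= M0 // mul0r (bigD1 i) //= mxE.
by rewrite ltn_eqF // mul0r.
Qed.

Lemma char_poly_block_trig (R : comNzRingType) n (M : 'M[R]_n)
    (blk : 'I_n -> nat) :
  (forall i k, (blk i < blk k)%N -> M i k = 0) ->
  char_poly M = char_poly (\matrix_(i, k) if blk i == blk k then M i k else 0).
Proof.
move=> M0; rewrite /char_poly (@det_block_trig _ _ _ blk).
  congr (\det _); apply/matrixP => i k; rewrite !mxE.
  have [->|/negPf neq_ik] := eqVneq i k; first by rewrite eqxx.
  by case: ifP; rewrite //= mulr0n subr0.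
move=> i k lt_ik; rewrite !mxE M0 // subr0.
by have [eq_ik|//] := eqVneq i k; rewrite eq_ik ltnn in lt_ik.
Qed.

Lemma char_poly_conj (R : comUnitRingType) n (P A : 'M[R]_n) :
  P \in unitmx -> char_poly (P *m A *m invmx P) = char_poly A.
Proof.
move=> uP; rewrite /char_poly.
have PK : map_mx polyC P *m map_mx polyC (invmx P) = 1%:M.
  by rewrite -map_mxM mulmxV // map_mx1.
have -> : char_poly_mx (P *m A *m invmx P) =
    map_mx polyC P *m char_poly_mx A *m map_mx polyC (invmx P).
  rewrite mulmxBr mulmxBl -!map_mxM; congr (_ - _).
  by rewrite scalar_mxC -mulmxA PK mulmx1.
rewrite !det_mulmx mulrC mulrA -det_mulmx.
by rewrite -map_mxM mulVmx // map_mx1 det1 mul1r.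
Qed.

Lemma char_poly_block_lower (R : comNzRingType) m n (A : 'M[R]_m)
    (C : 'M[R]_(n, m)) (D : 'M[R]_n) :
  char_poly (block_mx A 0 C D) = char_poly A * char_poly D.
Proof.
rewrite /char_poly /char_poly_mx map_block_mx /= map_mx0 scalar_mx_block.
by rewrite opp_block_mx add_block_mx subr0 det_lblock.
Qed.

(** Induction on an eigenvector. Vectors are rows, so taking it as the first row of [Q] clears the
    rest of the first row of the conjugate, and the result is lower triangular. *)
Lemma trig_similar (E : closedFieldType) n (A : 'M[E]_n) :
  exists2 P, P \in unitmx & is_trig_mx (P *m A *m invmx P).
Proof.
elim: n A => [|n IHn] A.
  by exists 1%:M; rewrite ?unitmx1 // flatmx0 mx0_is_trig.
have /closed_rootP[a] : size (char_poly A) != 1 by rewrite size_char_poly.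
rewrite -eigenvalue_root_char => /eigenvalueP[v vA v_neq0].
pose e0 : 'rV[E]_n.+1 := delta_mx 0 0.
have rank_e0 : \rank e0 = 1%N by rewrite mxrank_delta.
have e0v : e0 *m (delta_mx 0 0 *m v) = v.
  by rewrite mulmxA mul_delta_mx [delta_mx _ _]mx11_scalar mxE eqxx mul1mx.
(* The matrix [delta_mx 0 0 *m v] sends [e0] to [v] but has rank 1; [complete_unitmx] replaces it by
   an invertible one with the same value at [e0]. *)
have [|Q uQ e0Q] := @complete_unitmx _ 1 n.+1 e0 (delta_mx 0 0 *m v).
  by rewrite e0v rank_e0 rank_rV v_neq0.
rewrite e0v in e0Q.
pose A1 : 'M[E]_(1 + n) := Q *m A *m invmx Q.
have e0A1 : e0 *m A1 = a *: e0.
  by rewrite /A1 !mulmxA -e0Q vA -scalemxAl {1}e0Q mulmxK.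
have A1_0 : ursubmx A1 = 0.
  apply/matrixP => i k; rewrite !mxE ord1.
  have /rowP/(_ (rshift 1 k)) := e0A1.
  rewrite -rowE !mxE /= mulr0 => h; rewrite -[RHS]h; apply: eq_bigr => j _.
  by congr (_ * _); congr ((Q *m A) _ j); apply: val_inj.
have [P uP trigP] := IHn (drsubmx A1).
pose P1 : 'M[E]_(1 + n) := block_mx 1%:M 0 0 P.
have uP1 : P1 \in unitmx by rewrite unitmxE det_lblock det1 mul1r -unitmxE.
have invP1 : invmx P1 = block_mx 1%:M 0 0 (invmx P).
  rewrite -[RHS]mul1mx -(mulVmx uP1) -mulmxA mulmx_block.
  rewrite !mul0mx !mulmx0 mul1mx !addr0 add0r mulmxV //.
  by rewrite -scalar_mx_block mulmx1.
exists (P1 *m Q : 'M_n.+1); first by rewrite unitmx_mul uP1.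
have -> : P1 *m Q *m A *m invmx (P1 *m Q) = P1 *m A1 *m invmx P1.
  by rewrite -[invmx (P1 *m Q)]/((P1 * Q : 'M_n.+1)^-1) invrM // /A1 !mulmxA.
rewrite invP1 -[A1]submxK A1_0 /P1 !mulmx_block.
rewrite !mul0mx !mulmx0 !mul1mx !mulmx1 ?addr0 !add0r ?mul0mx.
set B := block_mx _ _ _ _.
have : @is_trig_mx E (1 + n) (1 + n) B.
  by rewrite is_trig_block_mx // mx11_is_trig trigP eqxx.
by [].
Qed.

(** A section [k] of [g] completes the rows of [f] to a basis in which [A] is block lower
    triangular, with diagonal blocks [A1] and [A2]. *)
Lemma char_poly_exact (E : fieldType) n1 n n2 (f : 'M[E]_(n1, n))
    (g : 'M[E]_(n, n2)) (A1 : 'M_n1) (A : 'M_n) (A2 : 'M_n2) :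
  row_free f -> row_full g -> (f == kermx g)%MS ->
  A1 *m f = f *m A -> A *m g = g *m A2 ->
  char_poly A = char_poly A1 * char_poly A2.
Proof.
move=> free_f full_g /eqmxP ker_g fA gA.
have def_n : n = (n1 + n2)%N.
  have := mxrank_ker g; rewrite -ker_g (eqP free_f) (eqP full_g) => ->.
  by rewrite subnK // -(eqP full_g) rank_leq_row.
case: _ / (esym def_n) in f g A free_f full_g ker_g fA gA *.
have [k gk] : exists k, k *m g = 1%:M by apply/row_fullP.
have fg : f *m g = 0 by apply/sub_kermxP; rewrite -ker_g.
pose P : 'M[E]_(n1 + n2) := col_mx f k.
have uP : P \in unitmx.
  rewrite -row_free_unit -kermx_eq0 -submx0; apply/rV_subP => u /sub_kermxP.
  rewrite -[u]hsubmxK mul_row_col => uP.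
  have : (lsubmx u *m f + rsubmx u *m k) *m g = 0 by rewrite uP mul0mx.
  rewrite mulmxDl -!mulmxA fg gk mulmx0 mulmx1 add0r => u2; move: uP.
  rewrite u2 mul0mx addr0 => /eqP; rewrite mulmx_free_eq0 // => /eqP ->.
  by rewrite row_mx0 sub0mx.
have [C defC] : exists C, k *m A - A2 *m k = C *m f.
  apply/submxP; rewrite ker_g; apply/sub_kermxP.
  by rewrite mulmxBl -!mulmxA gA gk mulmxA gk mul1mx mulmx1 subrr.
rewrite -(char_poly_conj A uP).
have -> : P *m A *m invmx P = block_mx A1 0 C A2.
  apply: (canLR (mulmxK uP)).
  by rewrite /P mul_col_mx mul_block_col mul0mx addr0 fA -defC subrK.
exact: char_poly_block_lower.
Qed.

(** * Eigenvalues with multiplicity, and Kronecker products *)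

Section Eigenvalues.

Variable E : closedFieldType.

(** The order of the list is arbitrary, but it depends on the characteristic polynomial alone:
    matrices with equal characteristic polynomials have literally the same list. *)
Definition eigs n (A : 'M[E]_n) : seq E :=
  sval (closed_field_poly_normal (char_poly A)).

Lemma eigsE n (A : 'M[E]_n) :
  char_poly A = \prod_(x <- eigs A) ('X - x%:P).
Proof.
rewrite /eigs; case: closed_field_poly_normal => s /= {1}->.
by rewrite (monicP (char_poly_monic A)) scale1r.
Qed.

Lemma perm_eigs n (A : 'M[E]_n) s :
  char_poly A = \prod_(x <- s) ('X - x%:P) -> perm_eq (eigs A) s.
Proof. by rewrite eigsE; apply: prod_XsubC_eq. Qed.

Lemma size_eigs n (A : 'M[E]_n) : size (eigs A) = n.
Proof.
by apply/succn_inj; rewrite -(size_char_poly A) eigsE size_prod_XsubC.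
Qed.

Lemma mem_eigs n (A : 'M[E]_n) x : (x \in eigs A) = root (char_poly A) x.
Proof. by rewrite eigsE root_prod_XsubC. Qed.

Lemma eigs_similar n (P A : 'M[E]_n) :
  P \in unitmx -> is_trig_mx (P *m A *m invmx P) ->
  perm_eq (eigs A) [seq (P *m A *m invmx P) i i | i <- enum 'I_n].
Proof.
move=> uP trigA; apply: perm_eigs.
by rewrite -(char_poly_conj A uP) char_poly_trig // big_map big_enum.
Qed.

Lemma big_eigs_similar (V : nmodType) (phi : E -> V) n (P A : 'M[E]_n) :
  P \in unitmx -> is_trig_mx (P *m A *m invmx P) ->
  \sum_(x <- eigs A) phi x = \sum_i phi ((P *m A *m invmx P) i i).
Proof.
by move=> uP tr; rewrite (perm_big _ (eigs_similar uP tr)) big_map big_enum.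
Qed.

Lemma mxtrace_eigs n (A : 'M[E]_n) : \tr A = \sum_(x <- eigs A) x.
Proof.
have [P uP trigP] := trig_similar A.
rewrite (big_eigs_similar id uP trigP).
by rewrite -[RHS]/(\tr _) mxtrace_mulC mulmxA mulVmx // mul1mx.
Qed.

(** [tprod] recurses on the rows of [A]. Splitting off the first block column as well exhibits the
    block triangular shape that the induction in [char_poly_tprod] uses; there [C] sits below the
    diagonal. *)
Lemma tprod_rsubmx m n (A : 'M[E]_(m, 1 + n)) m2 n2 (B : 'M[E]_(m2, n2)) :
  exists C, tprod A B = row_mx C (tprod (rsubmx A) B).
Proof.
elim: m n A m2 n2 B => [|m IHm] n A m2 n2 B.
  by exists 0; apply/matrixP => - [].
have [C defC] := IHm n (@dsubmx _ 1 m _ A) m2 n2 B.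
exists (col_mx (lsubmx (@usubmx _ 1 m _ A) 0 0 *: B) C).
rewrite /= defC -[LHS]block_mxEv block_mxEh.
congr (row_mx _ (col_mx _ (tprod _ B))); last first.
  by apply/matrixP => i k; rewrite !mxE.
by congr (trow _ B); apply/matrixP => i k; rewrite !mxE.
Qed.

Lemma char_poly_tprod m n (A : 'M[E]_m) (B : 'M[E]_n) :
  is_trig_mx A -> char_poly (tprod A B) = \prod_i char_poly (A i i *: B).
Proof.
elim: m A => [|m IHm] A trigA.
  by rewrite big_ord0 /char_poly det_mx00.
rewrite big_ord_recl.
have [C defC] := tprod_rsubmx (@dsubmx _ 1 m _ A) B.
rewrite /= defC.
have trig1 : @is_trig_mx _ (1 + m) (1 + m) A by [].
have -> : @rsubmx _ 1 1 m (@usubmx _ 1 m _ A) = 0.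
  by rewrite -[LHS]/(ursubmx (A : 'M_(1 + m))) ursubmx_trig.
rewrite -trowbE linear0 -block_mxEv.
have -> : @rsubmx _ m 1 m (@dsubmx _ 1 m _ A) = @drsubmx _ 1 m 1 m A.
  by apply/matrixP => i k; rewrite !mxE.
rewrite [char_poly _]char_poly_block_lower IHm; last first.
  exact: drsubmx_trig trig1.
congr (_ * _).
  by congr (char_poly (_ *: B)); rewrite !mxE; congr (A _ _); apply: val_inj.
apply: eq_bigr => i _; congr (char_poly (_ *: B)); rewrite !mxE.
by congr (A _ _); apply: val_inj.
Qed.

Lemma big_eigs_tprod (V : nmodType) (phi : E -> V) m n (A : 'M[E]_m)
    (B : 'M[E]_n) :
  \sum_(z <- eigs (tprod A B)) phi z =
  \sum_(x <- eigs A) \sum_(y <- eigs B) phi (x * y).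
Proof.
have [P uP trA] := trig_similar A; have [Q uQ trB] := trig_similar B.
set A1 := P *m A *m _ in trA; set B1 := Q *m B *m _ in trB.
have PQ1 : tprod P Q *m tprod (invmx P) (invmx Q) = 1%:M.
  by rewrite -tprodE !mulmxV // tprod1.
have [uPQ _] := mulmx1_unit PQ1.
have invPQ : tprod (invmx P) (invmx Q) = invmx (tprod P Q).
  by rewrite -[LHS]mul1mx -(mulVmx uPQ) -mulmxA PQ1 mulmx1.
have cpAB : char_poly (tprod A B) =
    \prod_(z <- [seq A1 i i * B1 k k | i <- enum 'I_m, k <- enum 'I_n])
      ('X - z%:P).
  rewrite -(char_poly_conj _ uPQ) -invPQ -!tprodE char_poly_tprod //.
  rewrite big_allpairs_dep big_enum /=; apply: eq_bigr => i _.
  have trZ : is_trig_mx (A1 i i *: B1).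
    by apply/is_trig_mxP => j k /(is_trig_mxP trB) B0; rewrite mxE B0 mulr0.
  rewrite (char_poly_trig trZ) big_enum /=.
  by apply: eq_bigr => k _; rewrite mxE.
rewrite (perm_big _ (perm_eigs cpAB)) big_allpairs_dep big_enum /=.
rewrite (big_eigs_similar _ uP trA); apply: eq_bigr => i _.
by rewrite (big_eigs_similar _ uQ trB) big_enum.
Qed.

End Eigenvalues.

(** * Symmetric powers and tensor products of matrices *)

Section SymmetricPowers.

Variable L : fieldType.
Implicit Types (A B p : {poly L}) (g h : 'M[L]_2).

(* Value at (A, B) of the form of degree n in two variables whose
   dehomogenization is p. *)
Definition form_eval n A B p : {poly L} :=
  \sum_(l < n.+1) p`_l *: (A ^+ (n - l) * B ^+ l).

Lemma form_evalM n A B c d p : (size p <= n.+1)%N ->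
  form_eval n.+1 A B ((c%:P + d%:P * 'X) * p) =
  (c *: A + d *: B) * form_eval n A B p.
Proof.
move=> size_p; rewrite mulrDl /form_eval.
under eq_bigr do rewrite coefD scalerDl mul_polyC coefZ.
rewrite big_split /= mulrDl; congr (_ + _).
  rewrite big_ord_recr /= (nth_default 0 size_p) mulr0 scale0r addr0.
  rewrite mulr_sumr; apply: eq_bigr => l _.
  by rewrite subSn ?leq_ord // exprS -scalerAl -scalerAr scalerA !mulrA.
rewrite big_ord_recl -mulrA coefCM coefXM mulr0 scale0r add0r.
rewrite mulr_sumr; apply: eq_bigr => l _.
rewrite coefCM coefXM /= -scalerAl -scalerAr scalerA.
by rewrite /bump /= add1n subSS exprS mulrCA.
Qed.

Lemma size_linear_form (c d : L) : (size (c%:P + d%:P * 'X)%R <= 2)%N.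
Proof.
rewrite (leq_trans (size_polyD _ _)) // geq_max size_polyC.
rewrite (leq_trans (leq_b1 _)) // mul_polyC (leq_trans (size_scale_leq _ _)) //.
by rewrite size_polyX.
Qed.

Lemma size_linear_forms (c d c' d' : L) k i :
  (size ((c%:P + d%:P * 'X) ^+ k * (c'%:P + d'%:P * 'X) ^+ i)%R
     <= (k + i).+1)%N.
Proof.
have size_exp (u v : L) j : (size ((u%:P + v%:P * 'X) ^+ j)%R <= j.+1)%N.
  apply: leq_trans (size_poly_exp_leq _ _) _; rewrite ltnS.
  rewrite -{2}[j]mul1n leq_mul2r; apply/orP; right.
  by rewrite -subn1 leq_subLR size_linear_form.
apply: leq_trans (size_polyMleq _ _) _.
rewrite -subn1 leq_subLR.
rewrite (leq_trans (leq_add (size_exp _ _ _) (size_exp _ _ _))) //.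
by rewrite addSn addnS.
Qed.

Lemma form_eval_linear A B c d c' d' k i :
  form_eval (k + i) A B ((c%:P + d%:P * 'X) ^+ k * (c'%:P + d'%:P * 'X) ^+ i) =
  (c *: A + d *: B) ^+ k * (c' *: A + d' *: B) ^+ i.
Proof.
elim: k => [|k IHk]; last first.
  rewrite exprS -mulrA addSn form_evalM ?size_linear_forms //.
  by rewrite IHk mulrA -exprS.
rewrite !mul1r; elim: i => [|i IHi].
  by rewrite /form_eval big_ord1 coef1 scale1r mulr1.
rewrite exprS add0n form_evalM ?IHi -?exprS //.
by have := size_linear_forms 0 0 c' d' 0 i; rewrite mul1r.
Qed.

(** Row i of [symm_mx n g] is the dehomogenization of a form of degree n. Evaluated at the two
    linear forms given by the rows of [h], it becomes row i for [g *m h], by [form_eval_linear]. *)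
Lemma symm_mxM n g h : symm_mx n (g *m h) = symm_mx n g *m symm_mx n h.
Proof.
apply/matrixP => i k; rewrite [LHS]mxE [RHS]mxE.
have le_in : (i <= n)%N by rewrite -ltnS.
have lin_mul (r : 'I_2) : ((g *m h) r 0)%:P + ((g *m h) r 1)%:P * 'X =
    g r 0 *: ((h 0 0)%:P + (h 0 1)%:P * 'X) +
    g r 1 *: ((h 1 0)%:P + (h 1 1)%:P * 'X).
  rewrite !mxE !big_ord_recl !big_ord0 !addr0.
  have -> : fintype.lift ord0 ord0 = 1 :> 'I_2 by apply: val_inj.
  rewrite !polyCD !polyCM -!mul_polyC !mulrDr mulrDl !mulrA.
  by rewrite addrACA.
rewrite !lin_mul -form_eval_linear subnK // /form_eval coef_sum.
apply: eq_bigr => l _.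
by rewrite coefZ [symm_mx n g i l]mxE [symm_mx n h l k]mxE.
Qed.

Lemma symm_mx1 n : symm_mx n (1%:M : 'M[L]_2) = 1%:M.
Proof.
apply/matrixP => i k; rewrite !mxE /= !polyC0 !mul0r addr0 add0r expr1n !mul1r.
by rewrite coefXn eq_sym.
Qed.

Lemma symm_mx_trig n g : is_trig_mx g -> is_trig_mx (symm_mx n g).
Proof.
move/is_trig_mxP => trig_g; apply/is_trig_mxP => i k lt_ik; rewrite mxE.
rewrite (trig_g 0 1) // polyC0 mul0r addr0 -polyC_exp mul_polyC coefZ.
rewrite nth_default ?mulr0 //.
have := size_linear_forms 0 0 (g 1 0) (g 1 1) 0 i; rewrite mul1r add0n.
by move/leq_trans; apply.
Qed.

Lemma symm_mx_trig_diag n g i : is_trig_mx g ->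
  symm_mx n g i i = g 0 0 ^+ (n - i) * g 1 1 ^+ i.
Proof.
move/is_trig_mxP => trig_g; rewrite mxE.
rewrite (trig_g 0 1) // polyC0 mul0r addr0 -polyC_exp mul_polyC coefZ.
congr (_ * _).
elim: (i : nat) => [|k IHk]; first by rewrite !expr0 coef1.
rewrite exprS mulrDl coefD mul_polyC coefZ [X in _ * X]nth_default.
  by rewrite mulr0 add0r -mulrA coefCM coefXM IHk exprS.
by have := size_linear_forms 0 0 (g 1 0) (g 1 1) 0 k; rewrite mul1r.
Qed.

Lemma symm_mx_unit n g : g \in unitmx -> symm_mx n g \in unitmx.
Proof.
move=> ug; have /mulmx1_unit[] // : symm_mx n g *m symm_mx n (invmx g) = 1%:M.
by rewrite -symm_mxM mulmxV // symm_mx1.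
Qed.

Lemma symm_mxV n g : g \in unitmx -> symm_mx n (invmx g) = invmx (symm_mx n g).
Proof.
move=> ug; have us := symm_mx_unit n ug.
rewrite -[LHS]mul1mx -(mulVmx us) -mulmxA -symm_mxM mulmxV //.
by rewrite symm_mx1 mulmx1.
Qed.

End SymmetricPowers.

Section TensorFamily.

Variables (L : fieldType) (J : finType) (n : J -> nat).
Implicit Types M : forall s : J, 'M[L]_((n s).+1, (n s).+1).

(** Distributivity when the index type of the inner sum varies with [s]: the functions are
    transported to [fprod], and the inner index types are merged into a tagged union. *)
Lemma big_dffun_distr (C : comNzRingType) (F : forall s : J, 'I_(n s).+1 -> C) :
  \sum_(f : alg_basis n) \prod_s F s (f s) = \prod_s \sum_i F s i.
Proof.
pose T_ (s : J) : finType := 'I_(n s).+1.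
pose P_ s : {ffun T_ s -> C} := [ffun i => F s i].
transitivity (\sum_(t : fprod T_) \prod_(s in J) P_ s (t s)).
  rewrite (reindex (@dffun_of_fprod J T_)) /=; last first.
    exact/onW_bij/dffun_of_fprod_bij.
  by apply: eq_bigr => t _; apply: eq_bigr => s _; rewrite !ffunE.
rewrite big_fprod -(bigA_distr_big_dep _ (fun s => untag 0 (P_ s))).
apply: eq_bigr => s _; rewrite -(@big_tag _ _ _ _ T_ (fun s => P_ s)).
by apply: eq_bigr => i _; rewrite ffunE.
Qed.

Definition tensor_mx M : 'M[L]_#|alg_basis n| :=
  \matrix_(a, b) \prod_s
    M s ((enum_val a : alg_basis n) s) ((enum_val b : alg_basis n) s).

Lemma tensor_mxM M1 M2 :
  tensor_mx (fun s => M1 s *m M2 s) = tensor_mx M1 *m tensor_mx M2.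
Proof.
apply/matrixP => a b; rewrite !mxE.
transitivity (\prod_s \sum_(i < (n s).+1)
    M1 s ((enum_val a : alg_basis n) s) i *
    M2 s i ((enum_val b : alg_basis n) s)).
  by apply: eq_bigr => s _; rewrite mxE.
rewrite -big_dffun_distr (reindex _ (onW_bij _ (@enum_val_bij (alg_basis n)))).
by apply: eq_bigr => c _; rewrite !mxE -big_split.
Qed.

Lemma tensor_mx1 : tensor_mx (fun s => 1%:M) = 1%:M.
Proof.
apply/matrixP => a b; rewrite !mxE.
have [->|neq_ab] := eqVneq a b.
  by rewrite big1 // => s _; rewrite mxE eqxx.
have [s neq_s] : exists s,
    (enum_val a : alg_basis n) s != (enum_val b : alg_basis n) s.
  apply/existsP; apply: contraR neq_ab; rewrite negb_exists => /forallP eq_ab.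
  apply/eqP/enum_val_inj/ffunP => s; apply/eqP; rewrite -[_ == _]negbK.
  exact: eq_ab.
by rewrite (bigD1 s) //= mxE (negPf neq_s) mul0r.
Qed.

(** A nonzero entry at (a, b) forces b <= a in every coordinate, which is only a partial order.
    Grading by the sum of the coordinates makes the matrix block triangular, and each block is
    diagonal because equal sums then force a = b. *)
Lemma char_poly_tensor_trig M : (forall s, is_trig_mx (M s)) ->
  char_poly (tensor_mx M) =
  \prod_(f : alg_basis n) ('X - (\prod_s M s (f s) (f s))%:P).
Proof.
move=> trigM.
pose blk (a : 'I_#|alg_basis n|) := \sum_s ((enum_val a : alg_basis n) s : nat).
have le_ent a b : tensor_mx M a b != 0 ->
    forall s, ((enum_val b : alg_basis n) s <= (enum_val a : alg_basis n) s)%N.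
  rewrite mxE => /prodf_neq0 Mab s; rewrite leqNgt; apply/negP => lt_s.
  by have := Mab s isT; rewrite (is_trig_mxP (trigM s)) ?eqxx.
rewrite (@char_poly_block_trig _ _ _ blk); last first.
  move=> a b; apply: contraTeq => /le_ent le_ab.
  by rewrite -leqNgt; apply: leq_sum => s _.
rewrite char_poly_trig; last first.
  apply/is_trig_mxP => a b lt_ab; rewrite mxE; case: eqP => // eq_blk.
  apply: contraTeq lt_ab => /le_ent le_ab; rewrite -leqNgt.
  suff -> : a = b by [].
  apply/enum_val_inj/ffunP => s; apply: val_inj; apply/eqP.
  have [_] := leqif_sum (fun s (_ : true) => leqif_eq (le_ab s)).
  rewrite -/(blk a) -/(blk b) eq_blk eqxx => /esym/forallP/(_ s).
  by rewrite eq_sym.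
rewrite (reindex _ (onW_bij _ (@enum_val_bij (alg_basis n)))) /=.
by apply: eq_bigr => a _; rewrite !mxE eqxx.
Qed.

End TensorFamily.

(** * The Brauer-Nesbitt theorem *)

Section GroupAlgebra.

Variables (E : closedFieldType) (gT : finGroupType) (G : {group gT}).
Implicit Types c d : gT -> E.

(** An element of the group algebra is encoded by its coefficient function, read on [G] only. *)
Definition galg_op n (rG : mx_representation E G n) c : 'M[E]_n :=
  \sum_(x in G) c x *: rG x.

Definition galg_mul c d x : E := \sum_(y in G) c y * d (y^-1 * x)%g.

Definition galg_elt (y x : gT) : E := (x == y)%:R.

Lemma galg_opM n (rG : mx_representation E G n) c d :
  galg_op rG (galg_mul c d) = galg_op rG c *m galg_op rG d.
Proof.
rewrite /galg_op mulmx_suml.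
under eq_bigr do rewrite /galg_mul scaler_suml.
rewrite exchange_big /=; apply: eq_bigr => y Gy; rewrite mulmx_sumr.
rewrite (reindex_inj (mulgI y)) /=.
apply: eq_big => [x|x]; rewrite groupMl // => Gx.
by rewrite mulKg repr_mxM // -scalemxAl -scalemxAr scalerA.
Qed.

Lemma galg_opE n (rG : mx_representation E G n) y :
  y \in G -> galg_op rG (galg_elt y) = rG y.
Proof.
move=> Gy; rewrite /galg_op (bigD1 y) //= /galg_elt eqxx scale1r big1 ?addr0 //.
by move=> x /andP[_ /negPf ->]; rewrite scale0r.
Qed.

Lemma galg_opZ n (rG : mx_representation E G n) a c :
  galg_op rG (fun x => a * c x) = a *: galg_op rG c.
Proof. by rewrite scaler_sumr; apply: eq_bigr => x _; rewrite scalerA. Qed.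

Lemma galg_op_sum n (rG : mx_representation E G n) (I : finType)
    (c : I -> gT -> E) :
  galg_op rG (fun x => \sum_i c i x) = \sum_i galg_op rG (c i).
Proof. by rewrite exchange_big; apply: eq_bigr => x _; rewrite scaler_suml. Qed.

Lemma galg_op_sub n (rG : mx_representation E G n) c d :
  galg_op rG (fun x => c x - d x) = galg_op rG c - galg_op rG d.
Proof.
by rewrite -sumrB; apply: eq_bigr => x _; rewrite scalerBl.
Qed.

Lemma mxtrace_galg_op n (rG : mx_representation E G n) c :
  \tr (galg_op rG c) = \sum_(x in G) c x * \tr (rG x).
Proof. by rewrite raddf_sum; apply: eq_bigr => x _; rewrite /= mxtraceZ. Qed.

(** Burnside's theorem: over a closed field an irreducible representation is absolutely irreducible,
    so the group algebra maps onto all matrices; [a] is a section of this map. *)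
Lemma irr_galg_op n (rG : mx_representation E G n) :
  mx_irreducible rG -> exists a, forall A, galg_op rG (a A) = A.
Proof.
move/group_closure_closed_field/mx_abs_irrP => [_ [a aP]].
by exists (fun A x => a x A) => A; rewrite [RHS]aP.
Qed.

Lemma irr_intertwiner n1 n2 (rG1 : mx_representation E G n1)
    (rG2 : mx_representation E G n2) (M : 'M[E]_(n2, n1)) :
  mx_irreducible rG1 -> mx_irreducible rG2 ->
  (forall x, x \in G -> rG2 x *m M = M *m rG1 x) -> M != 0 ->
  mx_rsim rG2 rG1.
Proof.
move=> /mx_irrP[n1_gt0 irr1] /mx_irrP[n2_gt0 irr2] homM M_neq0.
have full_M : row_full M.
  have : row_full <<M>>%MS.
    apply: irr1; last by rewrite -mxrank_eq0 genmxE mxrank_eq0.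
    apply/mxmoduleP => x Gx; rewrite (eqmxMr _ (genmxE M)) genmxE -homM //.
    exact: submxMl.
  by rewrite /row_full genmxE.
have free_M : row_free M.
  rewrite -kermx_eq0; apply/negPn/negP => ker_neq0.
  have : row_full (kermx M).
    apply: irr2 => //; apply/mxmoduleP => x Gx; apply/sub_kermxP.
    by rewrite -mulmxA homM // mulmxA mulmx_ker mul0mx.
  rewrite -sub1mx => /sub_kermxP; rewrite mul1mx => M0.
  by rewrite M0 eqxx in M_neq0.
exists M => //.
by rewrite -(eqP free_M) (eqP full_M).
Qed.

(** Either the annihilator of [rG2] acts nontrivially on [rG1], and its image, a nonzero two-sided
    ideal of a full matrix algebra, contains 1; or the action on [rG1] factors through that on
    [rG2], and Schur's lemma yields an isomorphism. *)
Lemma irr_separate n1 n2 (rG1 : mx_representation E G n1)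
    (rG2 : mx_representation E G n2) :
  mx_irreducible rG1 -> mx_irreducible rG2 -> ~ mx_rsim rG2 rG1 ->
  exists c, galg_op rG1 c = 1%:M /\ galg_op rG2 c = 0.
Proof.
move=> irr1 irr2 nsim.
have [a1 a1P] := irr_galg_op irr1; have [a2 a2P] := irr_galg_op irr2.
have [[c [c2 c1]] | ann] :=
    pselect (exists c, galg_op rG2 c = 0 /\ galg_op rG1 c != 0).
  set B := galg_op rG1 c in c1.
  have [k [l Bkl]] : exists k l, B k l != 0.
    move: c1; apply: contra_neqP => /forallNP B0; apply/matrixP => k l.
    rewrite mxE; apply: contra_notP (B0 k) => Bkl; exists l; exact/eqP.
  (* In terms of matrix units, E_ik B E_li = B_kl E_ii, and these sum over i to the scalar B_kl. *)
  exists (fun x => \sum_i (B k l)^-1 *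
    galg_mul (a1 (delta_mx i k)) (galg_mul c (a1 (delta_mx l i))) x).
  rewrite !galg_op_sum; split; last first.
    rewrite big1 // => i _.
    by rewrite galg_opZ !galg_opM c2 mul0mx mulmx0 scaler0.
  under eq_bigr => i _ do rewrite galg_opZ !galg_opM !a1P -/B.
  apply/matrixP => i i'; rewrite summxE mxE.
  have ent j : ((B k l)^-1 *: (delta_mx j k *m (B *m delta_mx l j))) i i' =
      ((i == j) && (j == i'))%:R.
    rewrite mulmxA !mxE (bigD1 l) //= big1 => [|u nu]; last first.
      by rewrite [delta_mx l j u i']mxE (negPf nu) mulr0.
    rewrite addr0 !mxE (bigD1 k) //= big1 => [|u nu]; last first.
      by rewrite mxE (negPf nu) andbF mul0r.
    rewrite mxE !eqxx andbT addr0 [i' == j]eq_sym.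
    case: (i == j); case: (j == i'); rewrite /= ?mul0r ?mulr0 //.
    by rewrite mul1r mulr1 mulVf.
  under eq_bigr do rewrite ent.
  rewrite (bigD1 i) //= eqxx big1 ?addr0 // => j /negPf.
  by rewrite eq_sym => ->.
(* From here on the operators on [rG2] determine those on [rG1], so [phi] below is a morphism of
   matrix algebras. *)
have {}ann c d : galg_op rG2 c = galg_op rG2 d -> galg_op rG1 c = galg_op rG1 d.
  move=> eq_cd; apply/eqP; rewrite -subr_eq0 -galg_op_sub.
  apply/negPn/negP => neq; apply: ann; exists (fun x => c x - d x).
  by rewrite galg_op_sub eq_cd subrr.
case: nsim.
pose phi A := galg_op rG1 (a2 A).
(* [M v w] maps a row vector u to v phi(w u). Multiplicativity of [phi] makes it an intertwiner, and
   phi(1) = 1 makes some [M v w] nonzero. *)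
pose M (v : 'rV_n1) (w : 'cV_n2) : 'M[E]_(n2, n1) :=
  \matrix_i (v *m phi (w *m delta_mx 0 i)).
have homM v w x : x \in G -> rG2 x *m M v w = M v w *m rG1 x.
  move=> Gx; apply/row_matrixP => i; rewrite !row_mul rowK mulmx_sum_row.
  under eq_bigr do rewrite rowK scalemxAr /phi -galg_opZ.
  rewrite -mulmx_sumr -galg_op_sum -mulmxA -(galg_opE rG1 Gx) /phi -galg_opM.
  congr (v *m _); apply: ann; rewrite galg_op_sum galg_opM galg_opE // a2P.
  under eq_bigr do rewrite galg_opZ a2P scalemxAr.
  rewrite -mulmx_sumr -mulmxA -rowE; congr (w *m _).
  by rewrite [RHS]row_sum_delta; apply: eq_bigr => j _; rewrite mxE.
have [[v [w Mvw]] | M0] := pselect (exists v w, M v w != 0).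
  exact: irr_intertwiner (homM v w) Mvw.
have phi0 (v : 'rV_n1) (w : 'cV_n2) i : v *m phi (w *m delta_mx 0 i) = 0.
  rewrite -[LHS](rowK (fun i => v *m phi (w *m delta_mx 0 i))) -/(M v w).
  have -> : M v w = 0 by apply: contra_notP M0 => /eqP Mvw; exists v, w.
  exact: row0.
have phi1 : galg_op rG1 (galg_elt 1) =
    galg_op rG1 (fun x => \sum_i a2 (delta_mx i (0 : 'I_1) *m delta_mx 0 i) x).
  apply: ann; rewrite galg_op_sum galg_opE // repr_mx1.
  under eq_bigr do rewrite a2P mul_delta_mx.
  exact: mx1_sum_delta.
have [n1_gt0 _] := (mx_irrP _).1 irr1.
have : delta_mx (0 : 'I_1) (Ordinal n1_gt0) *m 1%:M = 0 :> 'rV[E]_n1.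
  rewrite -(repr_mx1 rG1) -galg_opE // phi1 galg_op_sum mulmx_sumr.
  by rewrite big1 // => i _; apply: phi0.
rewrite mulmx1 => /rowP/(_ (Ordinal n1_gt0))/eqP.
by rewrite !mxE !eqxx oner_eq0.
Qed.

Implicit Types S : nat -> {n : nat & mx_representation E G n}.

Lemma irr_family_separate S k i :
  (i < k)%N -> (forall j, (j < k)%N -> mx_irreducible (projT2 (S j))) ->
  (forall j, (j < k)%N -> j != i ->
     ~ mx_rsim (projT2 (S j)) (projT2 (S i))) ->
  exists c, galg_op (projT2 (S i)) c = 1%:M /\
    forall j, (j < k)%N -> j != i -> galg_op (projT2 (S j)) c = 0.
Proof.
move=> lt_ik irrS nsim.
suff sep l : (l <= k)%N -> exists c, galg_op (projT2 (S i)) c = 1%:M /\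
    forall j, (j < l)%N -> j != i -> galg_op (projT2 (S j)) c = 0.
  exact: sep.
elim: l => [_ | l IHl lt_lk].
  by exists (galg_elt 1); rewrite galg_opE // repr_mx1.
have [c [c1 c0]] := IHl (ltnW lt_lk).
have [l_i | l_neq_i] := eqVneq l i.
  exists c; split=> // j; rewrite ltnS leq_eqVlt => /predU1P[-> | /c0 //].
  by rewrite l_i eqxx.
have [d [d1 d0]] :=
  irr_separate (irrS _ lt_ik) (irrS _ lt_lk) (nsim _ lt_lk l_neq_i).
exists (galg_mul c d); split=> [|j]; first by rewrite galg_opM c1 d1 mulmx1.
rewrite galg_opM ltnS leq_eqVlt => /predU1P[-> _ | /c0 c0j /c0j ->].
  by rewrite d0 mulmx0.
by rewrite mul0mx.
Qed.

(** Extend the relation linearly to the group algebra and evaluate it at an element that acts on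
    [S i] as a diagonal matrix unit and on the others as 0. A matrix unit has trace 1, whereas the
    trace of the identity may vanish in characteristic p. *)
Lemma irr_trace_independent S k (a : nat -> E) :
  (forall j, (j < k)%N -> mx_irreducible (projT2 (S j))) ->
  (forall i j, (i < k)%N -> (j < k)%N -> j != i ->
     ~ mx_rsim (projT2 (S j)) (projT2 (S i))) ->
  (forall x, x \in G -> \sum_(j < k) a j * \tr (projT2 (S j) x) = 0) ->
  forall i, (i < k)%N -> a i = 0.
Proof.
move=> irrS nsim tr0 i lt_ik.
have {}tr0 c : \sum_(j < k) a j * \tr (galg_op (projT2 (S j)) c) = 0.
  under eq_bigr => j _ do rewrite mxtrace_galg_op mulr_sumr.
  rewrite exchange_big big1 // => x Gx.
  under eq_bigr do rewrite mulrCA.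
  by rewrite -mulr_sumr tr0 ?mulr0.
have [c [c1 c0]] := irr_family_separate lt_ik irrS (nsim i ^~ lt_ik).
have [b bP] := irr_galg_op (irrS _ lt_ik).
have [n_gt0 _] := (mx_irrP _).1 (irrS _ lt_ik).
pose o := Ordinal n_gt0.
have := tr0 (galg_mul c (b (delta_mx o o))).
rewrite (bigD1 (Ordinal lt_ik)) //= galg_opM c1 mul1mx bP big1 => [|j ne_ji].
  suff -> : \tr (delta_mx o o : 'M[E]_(projT1 (S i))) = 1.
    by rewrite addr0 mulr1.
  rewrite /mxtrace (bigD1 o) //= mxE !eqxx big1 ?addr0 // => u /negPf nu.
  by rewrite mxE nu.
by rewrite galg_opM c0 // mul0mx mxtrace0 mulr0.
Qed.

End GroupAlgebra.

(** * Composition factors and their multiplicities *)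

Section BrauerNesbitt.

Variables (R : realType) (E : closedFieldType) (gT : finGroupType).
Variable G : {group gT}.
Local Notation obj := (repr_obj E G).
Implicit Types (V : obj) (S : seq obj) (l : seq nat).

Lemma short_exact_submod n (rG : mx_representation E G n) (U : 'M[E]_n)
    (modU : mxmodule rG U) :
  short_exact (submod_repr modU) rG (factmod_repr modU).
Proof.
exists (val_submod 1%:M), (in_factmod U 1%:M); split.
- by move=> x Gx; rewrite -val_submodE -[submod_repr _ _]mul1mx val_submodJ.
- move=> x Gx; rewrite -in_factmodE -[X in in_factmod _ X]mul1mx.
  by rewrite -in_factmodJ ?mul1mx.
- by rewrite /row_free val_submod1.
- apply/row_fullP; exists (val_factmod 1%:M).
  by rewrite -in_factmodE val_factmodK.
apply/eqmxP/(eqmx_trans (val_submod1 U)).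
apply/eqmxP/andP; split.
  by apply/sub_kermxP; rewrite -in_factmodE; apply/eqP; rewrite in_factmod_eq0.
apply/rV_subP => u /sub_kermxP; rewrite -in_factmodE => /eqP.
by rewrite in_factmod_eq0.
Qed.

Lemma char_poly_short_exact n1 n n2 (V1 : mx_representation E G n1)
    (V : mx_representation E G n) (V2 : mx_representation E G n2) x :
  short_exact V1 V V2 -> x \in G ->
  char_poly (V x) = char_poly (V1 x) * char_poly (V2 x).
Proof.
case=> f [g [fV gV free_f full_g fg]] Gx.
by apply: char_poly_exact free_f full_g fg _ _; [apply: fV | apply: gV].
Qed.

Lemma short_exact_dim n1 n n2 (V1 : mx_representation E G n1)
    (V : mx_representation E G n) (V2 : mx_representation E G n2) :
  short_exact V1 V V2 -> n = (n1 + n2)%N.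
Proof.
move=> /char_poly_short_exact/(_ (group1 G)).
move=> /(congr1 (fun p : {poly E} => size p)).
rewrite size_monicM ?char_poly_monic ?monic_neq0 ?char_poly_monic //.
by rewrite !size_char_poly addSn addnS => -[].
Qed.

Lemma rep_class_dim0 (V : mx_representation E G 0) : rep_class R V = 0.
Proof.
have ex : short_exact V V V.
  exists 1%:M, 1%:M; split=> [x _|x _||| ]; rewrite ?mul1mx ?mulmx1 //.
  - by rewrite row_free_unit unitmx1.
  - by rewrite row_full_unit unitmx1.
  by rewrite [1%:M]flatmx0 [kermx _]flatmx0 submx_refl.
by apply: (addrI (rep_class R V)); rewrite addr0 -(rep_class_exact R ex).
Qed.

Local Notation class V := (rep_class R (projT2 V)).
Local Notation chi V x := (char_poly (projT2 V x)).
Local Notation reg := (existT _ _ (regular_repr E G) : obj).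
Local Notation "S `[ i ]" := (nth reg S i) (at level 2, left associativity).

Definition irr_family S :=
  (forall i, (i < size S)%N -> mx_irreducible (projT2 S`[i])) /\
  (forall i k, (i < size S)%N -> (k < size S)%N -> k != i ->
     ~ mx_rsim (projT2 S`[k]) (projT2 S`[i])).

(** The list [l] gives the composition factors as positions in [S], with repetition. One and the
    same list computes the class [c] and the characteristic polynomials [f], which is how the latter
    come to determine the former. *)
Definition constituents S (c : rep_group R E G) (f : gT -> {poly E}) l :=
  [/\ all (gtn (size S)) l, c = \sum_(i <- l) class S`[i] &
      forall x, x \in G -> f x = \prod_(i <- l) chi S`[i] x].

Lemma constituents_cat S T c f l :
  constituents S c f l -> constituents (S ++ T) c f l.
Proof.
case=> lS classV chiV; split.
- by apply: sub_all lS => i /= /leq_trans; apply; rewrite size_cat leq_addr.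
- rewrite classV !big_seq; apply: eq_bigr => i /(allP lS) /= lt_i.
  by rewrite nth_cat lt_i.
move=> x Gx; rewrite chiV // !big_seq; apply: eq_bigr => i /(allP lS) /= lt_i.
by rewrite nth_cat lt_i.
Qed.

Lemma rsim_class V1 V2 : mx_rsim (projT2 V1) (projT2 V2) ->
  class V1 = class V2 /\ forall x, x \in G -> chi V1 x = chi V2 x.
Proof.
case: V1 V2 => n1 V1 [n2 V2] /= [B def_n]; case: _ / def_n V2 B => V2 B.
rewrite row_free_unit => uB homB.
(* The only relations in [rep_group] come from short exact sequences, so an isomorphism is turned
   into one with quotient 0. *)
have repr0 : mx_repr G (fun _ => 1%:M : 'M[E]_0).
  by split=> // x y _ _; rewrite mulmx1.
pose Z := MxRepresentation repr0.
have ex : short_exact V1 V2 Z.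
  exists B, 0; split=> [x Gx|x Gx|||]; first exact: homB.
  - by rewrite mulmx0 mul0mx.
  - by rewrite row_free_unit.
  - by rewrite /row_full mxrank0.
  apply/andP; split; first by apply/sub_kermxP; rewrite mulmx0.
  by apply: submx_full; rewrite row_full_unit.
split; first by rewrite (rep_class_exact R ex) rep_class_dim0 addr0.
move=> x Gx; rewrite (char_poly_short_exact ex Gx).
by rewrite [char_poly (Z x)]det_mx00 mulr1.
Qed.

(** A composition series, by induction on the dimension. The family is only ever extended at its
    end, so earlier positions stay valid and several representations can be decomposed over a common
    family. *)
Lemma constituents_exist V S : irr_family S ->
  exists T, irr_family (S ++ T) /\ exists l,
    constituents (S ++ T) (class V) (fun x => chi V x) l.
Proof.
have [k] := ubnP (projT1 V); elim: k V S => // k IHk [n V] S /= lt_nk irrS.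
have [n0 | n_gt0] := posnP n.
  exists [::]; rewrite cats0; split=> //; exists [::]; split=> //=.
    by move: V; rewrite n0 => V; rewrite big_nil rep_class_dim0.
  move=> x _; move: V; rewrite n0 => V.
  by rewrite big_nil [char_poly _]det_mx00.
have [irrV | redV] := pselect (mx_irreducible V).
  have [[i [lt_iS sim_i]] | nsim] := pselect (exists i, (i < size S)%N /\
      mx_rsim V (projT2 S`[i])).
    exists [::]; rewrite cats0; split=> //; exists [:: i].
    have [classV chiV] := @rsim_class (existT _ n V) S`[i] sim_i.
    split; first by rewrite /= lt_iS.
      by rewrite big_seq1.
    by move=> x Gx; rewrite big_seq1 -chiV.
  exists [:: existT _ n V]; rewrite cats1; split; last first.
    exists [:: size S]; split.
    - by rewrite /= size_rcons ltnSn.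
    - by rewrite big_seq1 nth_rcons ltnn eqxx.
    by move=> x Gx; rewrite big_seq1 nth_rcons ltnn eqxx.
  have [irr_i nsim_ij] := irrS.
  split=> [i | i j]; rewrite size_rcons !ltnS.
    rewrite leq_eqVlt nth_rcons => /predU1P[-> | lt_i]; last first.
      by rewrite lt_i; apply: irr_i.
    by rewrite ltnn eqxx.
  rewrite leq_eqVlt => /predU1P[-> | lt_i]; rewrite leq_eqVlt.
    case/predU1P=> [-> | lt_j]; first by rewrite eqxx.
    rewrite !nth_rcons lt_j ltnn eqxx => _ /mx_rsim_sym sim.
    by apply: nsim; exists j.
  case/predU1P=> [-> _ | lt_j]; rewrite !nth_rcons lt_i ?lt_j.
    by rewrite ltnn eqxx => sim; apply: nsim; exists i.
  exact: nsim_ij.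
have [U [modU nzU nfullU]] :
    exists U : 'M_n, [/\ mxmodule V U, U != 0 & ~~ row_full U].
  apply: contra_notP redV => noU; apply/mx_irrP; split=> // U modU nzU.
  by apply: contra_notT noU => nfullU; exists U.
have ex := short_exact_submod modU.
have def_n := short_exact_dim ex.
have rankU : (0 < \rank U)%N by rewrite lt0n mxrank_eq0.
have lt_U : (\rank U < n)%N.
  by rewrite ltn_neqAle rank_leq_col andbT.
have [T1 [irr1 [l1 dec1]]] := IHk (existT _ _ (submod_repr modU)) S
  (leq_trans lt_U lt_nk) irrS.
have [|T2 [irr2 [l2 [l2S class2 chi2]]]] :=
    IHk (existT _ _ (factmod_repr modU)) (S ++ T1) _ irr1.
  rewrite /=; apply: leq_trans (lt_nk : (n <= k)%N).
  by rewrite [X in (_ < X)%N]def_n -[X in (X < _)%N]add0n ltn_add2r.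
have [l1S class1 chi1] := constituents_cat T2 dec1.
rewrite -catA in irr2 l1S class1 chi1 l2S class2 chi2.
exists (T1 ++ T2); split=> //; exists (l1 ++ l2); split.
- by rewrite all_cat l1S.
- by rewrite (rep_class_exact R ex) big_cat /=; congr (_ + _).
move=> x Gx; rewrite (char_poly_short_exact ex Gx) big_cat /=.
by congr (_ * _); [apply: chi1 | apply: chi2].
Qed.

Lemma constituents_seq (Vs : seq obj) S : irr_family S ->
  exists T, irr_family (S ++ T) /\ exists l,
    constituents (S ++ T) (\sum_(V <- Vs) class V)
      (fun x => \prod_(V <- Vs) chi V x) l.
Proof.
elim: Vs S => [|V Vs IH] S irrS.
  exists [::]; rewrite cats0; split=> //; exists [::].
  by split=> // [|x _]; rewrite !big_nil.
have [T1 [irr1 [l1 dec1]]] := constituents_exist V irrS.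
have [T2 [irr2 [l2 [l2S class2 chi2]]]] := IH _ irr1.
have [l1S class1 chi1] := constituents_cat T2 dec1.
rewrite -catA in irr2 l1S class1 chi1 l2S class2 chi2.
exists (T1 ++ T2); split=> //; exists (l1 ++ l2); split.
- by rewrite all_cat l1S.
- by rewrite big_cons big_cat /= class1 class2.
by move=> x Gx; rewrite big_cons big_cat /= chi1 // chi2.
Qed.

Lemma sum_count (V : nmodType) (F : nat -> V) k l : all (gtn k) l ->
  \sum_(i <- l) F i = \sum_(i < k) F i *+ count_mem (i : nat) l.
Proof.
elim: l => [_ | i l IHl /= /andP[lt_ik lk]].
  by rewrite big_nil big1.
rewrite big_cons IHl // [in RHS](bigD1 (Ordinal lt_ik)) //= eqxx mulrSr.
rewrite [in LHS](bigD1 (Ordinal lt_ik)) //= addrCA addrA; congr (_ + _).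
by apply: eq_bigr => j /negPf; rewrite -val_eqE eq_sym /= => ->.
Qed.

Lemma mxtrace_prod_char_poly l1 l2 S x :
  \prod_(i <- l1) chi S`[i] x = \prod_(i <- l2) chi S`[i] x ->
  \sum_(i <- l1) \tr (projT2 S`[i] x) = \sum_(i <- l2) \tr (projT2 S`[i] x).
Proof.
have prodE l : \prod_(i <- l) chi S`[i] x =
    \prod_(e <- flatten [seq eigs (projT2 S`[i] x) | i <- l]) ('X - e%:P).
  by rewrite big_flatten big_map; apply: eq_bigr => i _; rewrite eigsE.
have sumE l : \sum_(i <- l) \tr (projT2 S`[i] x) =
    \sum_(e <- flatten [seq eigs (projT2 S`[i] x) | i <- l]) e.
  by rewrite big_flatten big_map; apply: eq_bigr => i _; rewrite mxtrace_eigs.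
by rewrite !prodE !sumE => /prod_XsubC_eq eq_e; apply: perm_big.
Qed.

Lemma perm_flatten_nseq l m :
  (forall i, m %| count_mem i l)%N ->
  exists l', perm_eq l (flatten (nseq m l')).
Proof.
move=> dvd_m.
exists (flatten [seq nseq (count_mem i l %/ m) i | i <- undup l]).
apply/allP => i _ /=; rewrite !count_flatten map_nseq sumn_nseq.
rewrite count_flatten -map_comp -{1}(divnK (dvd_m i)); apply/eqP.
congr (_ * m)%N; rewrite sumnE big_map.
have cnt k : count_mem i (nseq (count_mem k l %/ m) k) =
    if k == i then (count_mem i l %/ m)%N else 0%N.
  by rewrite count_nseq /=; case: eqP => [->|]; rewrite ?mul1n ?mul0n.
under eq_bigr do rewrite /= cnt.
rewrite -big_mkcond /= -big_filter.
have [il | nil] := boolP (i \in l).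
  rewrite filter_pred1_uniq ?undup_uniq ?mem_undup // big_seq1 //.
rewrite (count_memPn nil) div0n big1 // => k _.
Qed.

(* By independence of traces, the multiplicities in l1 and l2 agree modulo p.
   Once the common constituents are cancelled, they are all divisible by p, and
   one can extract p-th roots of the two products. *)
Lemma irr_char_poly_perm p S l1 l2 :
  p \in [pchar E] -> irr_family S ->
  all (gtn (size S)) l1 -> all (gtn (size S)) l2 ->
  (forall x, x \in G ->
    \prod_(i <- l1) chi S`[i] x = \prod_(i <- l2) chi S`[i] x) ->
  perm_eq l1 l2.
Proof.
move=> pE [irrS nsim].
have [k] := ubnP (size l1 + size l2); elim: k l1 l2 => // k IHk l1 l2.
rewrite ltnS => le_k l1S l2S eq_chi.
have chi_neq0 i x : chi S`[i] x != 0.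
  by rewrite monic_neq0 ?char_poly_monic.
have tr0 i : (i < size S)%N ->
    (count_mem i l1)%:R - (count_mem i l2)%:R = 0 :> E.
  apply: (irr_trace_independent (S := nth reg S)
    (a := fun i => (count_mem i l1)%:R - (count_mem i l2)%:R)
    irrS nsim) => x Gx.
  under eq_bigr do rewrite mulrBl !mulr_natl.
  pose tr i := \tr (projT2 S`[i] x).
  rewrite sumrB -(sum_count tr l1S) -(sum_count tr l2S).
  by apply/eqP; rewrite subr_eq0; apply/eqP/mxtrace_prod_char_poly/eq_chi.
have [/hasP[i il1 il2] | disj] := boolP (has (mem l2) l1).
  rewrite (perm_trans (perm_to_rem il1)) // perm_sym.
  rewrite (perm_trans (perm_to_rem il2)) // perm_cons perm_sym.
  apply: IHk.
  - rewrite !size_rem //; apply: leq_trans le_k.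
    by case: (l1) il1 => // ? ? _; rewrite addSn ltnS leq_add2l leq_pred.
  - by apply/allP => j /mem_rem; apply: (allP l1S).
  - by apply/allP => j /mem_rem; apply: (allP l2S).
  move=> x Gx; apply: (mulfI (chi_neq0 i x)).
  have remE l : i \in l -> chi S`[i] x * \prod_(j <- rem i l) chi S`[j] x =
      \prod_(j <- l) chi S`[j] x.
    by move=> il; rewrite (perm_big _ (perm_to_rem il)) big_cons.
  by rewrite !remE ?eq_chi.
have dvd_p i : ((p %| count_mem i l1) && (p %| count_mem i l2))%N.
  have [lt_i | ge_i] := ltnP i (size S); last first.
    have ni l : all (gtn (size S)) l -> count_mem i l = 0%N.
      move=> lS; apply/count_memPn; apply: contraL ge_i => /(allP lS).
      by rewrite -ltnNge.
    by rewrite !ni ?dvdn0.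
  have /eqP := tr0 i lt_i; rewrite subr_eq0 => /eqP eq_cnt.
  have [il1 | nil1] := boolP (i \in l1).
    have il2 : i \notin l2 by apply: contra disj => ?; apply/hasP; exists i.
    rewrite (count_memPn il2) in eq_cnt *.
    by rewrite dvdn0 andbT (dvdn_pcharf pE) eq_cnt.
  rewrite (count_memPn nil1) in eq_cnt *.
  by rewrite dvdn0 (dvdn_pcharf pE) -eq_cnt mulr0n eqxx.
have [l1' perm1] := @perm_flatten_nseq l1 p (fun i => proj1 (andP (dvd_p i))).
have [l2' perm2] := @perm_flatten_nseq l2 p (fun i => proj2 (andP (dvd_p i))).
have p_gt1 := prime_gt1 (pcharf_prime pE).
(* Dividing the multiplicities by p decreases the total size only if it is positive. *)
have [s0 | s_gt0] := posnP (size l1 + size l2)%N.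
  by move: s0 => /eqP; rewrite addn_eq0 !size_eq0 => /andP[/eqP-> /eqP->].
have size_l : (size l1 + size l2 = p * (size l1' + size l2'))%N.
  rewrite (perm_size perm1) (perm_size perm2) !size_flatten /shape !map_nseq.
  by rewrite !sumn_nseq -mulnDl mulnC.
suff perm' : perm_eq l1' l2'.
  rewrite (perm_trans perm1) // perm_sym (perm_trans perm2) //.
  apply/seq.permP => a; rewrite !count_flatten !map_nseq.
  by rewrite (seq.permP perm').
apply: IHk.
- apply: leq_trans le_k; rewrite size_l ltn_Pmull //.
  by rewrite lt0n; apply: contraTneq s_gt0 => s0; rewrite size_l s0 muln0.
- apply/allP => i il; apply: (allP l1S); rewrite (perm_mem perm1).
  apply/flattenP; exists l1' => //.
  by rewrite -(prednK (ltnW p_gt1)) mem_head.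
- apply/allP => i il; apply: (allP l2S); rewrite (perm_mem perm2).
  apply/flattenP; exists l2' => //.
  by rewrite -(prednK (ltnW p_gt1)) mem_head.
(* The products over p copies are p-th powers, and the Frobenius morphism of [{poly E}] is
   injective. *)
move=> x Gx; have pP : p \in [pchar {poly E}] by rewrite pchar_poly.
have prod_p l : \prod_(i <- flatten (nseq p l)) chi S`[i] x =
    (\prod_(i <- l) chi S`[i] x) ^+ p.
  by rewrite big_flatten big_nseq iter_mulr_1.
have := eq_chi x Gx; rewrite (perm_big _ perm1) (perm_big _ perm2) /= !prod_p.
move=> /eqP; rewrite -subr_eq0 -!(pFrobenius_autE pP) -rmorphB /=.
by rewrite pFrobenius_autE expf_eq0 subr_eq0 => /andP[_ /eqP].
Qed.

(** It is stated for sums of representations because identities with integer coefficients in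
    [rep_group] are proved by moving the negative terms across. *)
Theorem brauer_nesbitt p (Vs1 Vs2 : seq obj) :
  p \in [pchar E] ->
  (forall x, x \in G ->
    \prod_(V <- Vs1) chi V x = \prod_(V <- Vs2) chi V x) ->
  \sum_(V <- Vs1) class V = \sum_(V <- Vs2) class V.
Proof.
move=> pE eq_chi.
have irr0 : irr_family [::] by [].
have [T1 [irr1 [l1 dec1]]] := constituents_seq Vs1 irr0.
have [T2 [irr2 [l2 [l2S class2 chi2]]]] := constituents_seq Vs2 irr1.
have [l1S class1 chi1] := constituents_cat T2 dec1.
rewrite class1 class2; apply/perm_big/(irr_char_poly_perm pE irr2) => // x Gx.
by rewrite -chi1 // -chi2 // eq_chi.
Qed.

End BrauerNesbitt.

(** * Invariants of a class in the Grothendieck group *)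

Section ClassInvariants.

Variables (R : realType) (E : closedFieldType) (gT : finGroupType).
Variable G : {group gT}.
Local Notation obj := {classic repr_obj E G}.

Definition obj_lift (f : obj -> R^o) : {freeg obj / R} -> R^o := fglift f.

HB.instance Definition _ f :=
  GRing.isZmodMorphism.Build {freeg obj / R} R^o (obj_lift f)
    (@lift_is_additive _ _ _ f).

Lemma obj_liftZ f (a : R) (D : {freeg obj / R}) :
  obj_lift f (a *: D) = a * obj_lift f D.
Proof.
rewrite -{2}[D]freeg_sumE [a *: D]/(fgscale a D) /fgscale.
rewrite !raddf_sum mulr_sumr /=; apply: eq_bigr => z _.
by rewrite /obj_lift !liftU -scalerA.
Qed.

(** Extended linearly to the free space on the representations, [f] vanishes on the relators, hence
    on their span. *)
Lemma class_invariant (f : repr_obj E G -> R) :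
  (forall n1 n n2 (V1 : mx_representation E G n1)
      (V : mx_representation E G n) (V2 : mx_representation E G n2),
    short_exact V1 V V2 ->
    f (existT _ n V) = f (existT _ n1 V1) + f (existT _ n2 V2)) ->
  forall n n' (V : mx_representation E G n) (V' : mx_representation E G n'),
    rep_class R V = rep_class R V' -> f (existT _ n V) = f (existT _ n' V').
Proof.
move=> f_add n n' V V' /rep_group_pi_eq/asboolP[s [s_rel def_s]].
have liftE m (X : mx_representation E G m) :
    obj_lift f (free_class R X) = f (existT _ m X).
  by rewrite /obj_lift liftU scale1r.
apply/eqP; rewrite -subr_eq0 -!liftE -raddfB def_s raddf_sum big_seq big1 //.
move=> y /s_rel[n1 [k [n2 [V1 [X [V2 [ex ->]]]]]]] /=.
rewrite obj_liftZ !raddfB /= !liftE (f_add _ _ _ _ _ _ ex).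
by rewrite -addrA -opprD subrr mulr0.
Qed.

(** The characteristic polynomial is multiplicative on short exact sequences, so [class_invariant]
    is applied to the multiplicity of each eigenvalue, which is additive and can be read in [R]. *)
Lemma rep_class_char_poly n n' (V : mx_representation E G n)
    (V' : mx_representation E G n') :
  rep_class R V = rep_class R V' ->
  forall x, x \in G -> char_poly (V x) = char_poly (V' x).
Proof.
move=> eqV x Gx.
suff eq_cnt e : count_mem e (eigs (V x)) = count_mem e (eigs (V' x)).
  have perm_e : perm_eq (eigs (V x)) (eigs (V' x)).
    by apply/allP => e _; rewrite /= eq_cnt.
  by rewrite !eigsE (perm_big _ perm_e).
pose f (X : repr_obj E G) : R := (count_mem e (eigs (projT2 X x)))%:R.
apply/eqP; rewrite -(eqr_nat R) -[X in X == _]/(f (existT _ n V)).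
rewrite (@class_invariant f _ _ _ _ _ eqV) // => n1 m n2 V1 X V2 ex.
rewrite /f /= -natrD -count_cat; congr (_%:R); apply/seq.permP/perm_eigs.
by rewrite (char_poly_short_exact ex Gx) !eigsE big_cat.
Qed.

Lemma rep_class_dim n n' (V : mx_representation E G n)
    (V' : mx_representation E G n') :
  rep_class R V = rep_class R V' -> n = n'.
Proof.
move=> eqV; apply/succn_inj; rewrite -(size_char_poly (V 1%g)).
by rewrite (rep_class_char_poly eqV (group1 G)) size_char_poly.
Qed.

End ClassInvariants.

(** * Characters of roots of unity *)

Lemma closed_prim_root_exists (E : closedFieldType) n :
  n%:R != 0 :> E -> exists z : E, n.-primitive_root z.
Proof.
move=> n_neq0; have n_gt0 : (0 < n)%N by case: n n_neq0 => //; rewrite eqxx.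
pose p : {poly E} := 'X^n - 1; have [r Dp] := closed_field_poly_normal p.
rewrite (monicP _) ?monicXnsubC // scale1r in Dp.
have rn1 : all n.-unity_root r.
  by apply/allP => z; rewrite -root_prod_XsubC -Dp.
have sz_r : (n < (size r).+1)%N.
  by rewrite -(size_prod_XsubC r id) -Dp size_XnsubC.
have [|z] := hasP (has_prim_root n_gt0 rn1 _ sz_r); last by exists z.
by rewrite -separable_prod_XsubC -Dp separable_Xn_sub_1.
Qed.

(* The family [chi] consists of all the characters of the group of the n-th
   roots of unity of [E]. *)
Lemma brauer_lift (E : closedFieldType) p n :
  p \in [pchar E] -> (0 < n)%N ->
  exists chi : nat -> E -> algC,
    [/\ forall t, chi t 1 = 1,
        forall t x y, x ^+ n = 1 -> y ^+ n = 1 ->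
          chi t (x * y) = chi t x * chi t y &
        forall s1 s2, (forall x, x \in s1 ++ s2 -> x ^+ n = 1) ->
          (forall t, \sum_(x <- s1) chi t x = \sum_(x <- s2) chi t x) ->
          perm_eq s1 s2].
Proof.
move=> pE n_gt0; have p_pr := pcharf_prime pE.
(* In characteristic p the only root of unity of p-power order is 1, so the n-th roots of unity are
   the k-th ones, with k the prime-to-p part of n. *)
pose k := (n`_p^')%N; have k_gt0 : (0 < k)%N := part_gt0 _ _.
have expk (x : E) : x ^+ n = 1 -> x ^+ k = 1.
  rewrite -{1}(partnC p n_gt0) mulnC exprM p_part.
  elim: (logn p n) => // i IHi.
  rewrite expnSr exprM -(pFrobenius_autE pE) => xp.
  by apply/IHi/(fmorph_inj (pFrobenius_aut pE)); rewrite rmorph1.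
have k_neq0 : k%:R != 0 :> E.
  by rewrite -(dvdn_pcharf pE) -p'natE // part_pnat.
have [z z_prim] := closed_prim_root_exists k_neq0.
have [w w_prim] := C_prim_root_exists k_gt0.
pose dlog x := oapp val 0%N [pick i : 'I_k | x == z ^+ i].
have dlogE x : x ^+ n = 1 -> x = z ^+ dlog x.
  move=> /expk xk; rewrite /dlog; case: pickP => [i /eqP // | no_i].
  by have [i x_i] := prim_rootP z_prim xk; have /eqP := no_i i.
(* The value t = 1 sends [z] to [w] and is the usual Brauer lift; the others are its powers. Outside
   the n-th roots of unity [dlog] may take its default value 0. *)
pose chi t x := w ^+ (t * dlog x).
have chi1 t : chi t 1 = 1.
  have /eqP := dlogE 1 (expr1n _ _); rewrite -{1}(expr0 z).
  rewrite (eq_prim_root_expr z_prim) eq_sym => dlog1.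
  have /eqP wlog1 : w ^+ dlog 1 == w ^+ 0 by rewrite (eq_prim_root_expr w_prim).
  by rewrite /chi mulnC exprM wlog1 expr1n.
have chiM t x y : x ^+ n = 1 -> y ^+ n = 1 -> chi t (x * y) = chi t x * chi t y.
  move=> xn yn; have xyn : (x * y) ^+ n = 1 by rewrite exprMn xn yn mulr1.
  have /eqP := dlogE _ xyn; rewrite {1}(dlogE _ xn) {1}(dlogE _ yn) -exprD.
  rewrite (eq_prim_root_expr z_prim) => dlogD.
  have /eqP wlog : w ^+ (dlog x + dlog y) == w ^+ dlog (x * y).
    by rewrite (eq_prim_root_expr w_prim).
  by rewrite /chi -exprD -mulnDr ![(t * _)%N]mulnC !exprM wlog.
exists chi; split=> // s1 s2 s_n eq_chi.
have orth x y : x ^+ n = 1 -> y ^+ n = 1 ->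
    \sum_(t < k) chi t x * chi t y^-1 = (x == y)%:R *+ k.
  move=> xn yn; have y_neq0 : y != 0.
    apply: contra_eq_neq yn => ->.
    by rewrite expr0n eqn0Ngt n_gt0 eq_sym oner_eq0.
  have xyn : (x / y) ^+ n = 1 by rewrite exprMn xn exprVn yn invr1 mulr1.
  pose u := w ^+ dlog (x / y).
  transitivity (\sum_(t < k) u ^+ t).
    apply: eq_bigr => t _.
    by rewrite -chiM ?exprVn ?yn ?invr1 // /chi mulnC exprM.
  have [eq_xy | neq_xy] := eqVneq x y.
    have u1 : u = 1 by rewrite /u eq_xy divff // -(chi1 1%N) /chi mul1n.
    by under eq_bigr do rewrite u1 expr1n; rewrite sumr_const card_ord.
  have u_neq1 : u != 1.
    apply: contra_neq neq_xy => /eqP.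
    rewrite -(expr0 w) (eq_prim_root_expr w_prim).
    rewrite -(eq_prim_root_expr z_prim) expr0 -dlogE // => /eqP /divr1_eq //.
  apply/eqP; rewrite mul0rn.
  have := subrX1 u k; rewrite -exprM mulnC exprM (prim_expr_order w_prim).
  rewrite expr1n subrr => /esym/eqP; rewrite mulf_eq0 subr_eq0 (negPf u_neq1).
  by [].
apply/allP => x /s_n xn; rewrite /= -(eqr_nat algC).
(* Fourier inversion: by orthogonality, the sums of [chi] over [s] recover k times the multiplicity
   of [x], and k is invertible in [algC]. *)
have cnt s : (forall y, y \in s -> y ^+ n = 1) ->
    \sum_(t < k) chi t x^-1 * (\sum_(y <- s) chi t y) =
    (count_mem x s)%:R *+ k.
  move=> sn; under eq_bigr do rewrite mulr_sumr.
  rewrite exchange_big /= big_seq.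
  under eq_bigr => y /sn yn.
    under eq_bigr do rewrite mulrC.
    rewrite orth //; over.
  rewrite -big_seq sumrMnl; congr (_ *+ k).
  rewrite -sum1_count natr_sum [RHS]big_mkcond.
  by apply: eq_bigr => y _; rewrite /=; case: eqP.
have := cnt s1; rewrite (eq_bigr _ (fun (t : 'I_k) _ => congr1 _ (eq_chi t))).
rewrite cnt => [eq_cnt|y ys]; last by apply: s_n; rewrite mem_cat ys orbT.
apply/eqP/(mulIf (x := k%:R)); first by rewrite pnatr_eq0 -lt0n.
rewrite !mulr_natr eq_cnt // => y ys.
by apply: s_n; rewrite mem_cat ys.
Qed.

(** * Reduction of integral matrices *)

Definition subring_prop (L : comNzRingType) (O : L -> Prop) :=
  [/\ O 1, forall x y, O x -> O y -> O (x - y) &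
      forall x y, O x -> O y -> O (x * y)].

Section SubringType.

Variables (L : comNzRingType) (O : L -> Prop) (OP : subring_prop O).

(* The unused argument gives canonical structures access to the closure
   properties. *)
Definition prop_pred of subring_prop O : {pred L} := fun x => `[<O x>].

Lemma prop_pred_subring : subring_closed (prop_pred OP).
Proof.
have [O1 OB OM] := OP; split; first exact/asboolP.
  by move=> x y /asboolP Ox /asboolP Oy; apply/asboolP/OB.
by move=> x y /asboolP Ox /asboolP Oy; apply/asboolP/OM.
Qed.

HB.instance Definition _ :=
  GRing.isSubringClosed.Build L (prop_pred OP) prop_pred_subring.

Definition prop_ring := {x | x \in prop_pred OP}.

HB.instance Definition _ := SubChoice.on prop_ring.
HB.instance Definition _ := [SubChoice_isSubComNzRing of prop_ring by <:].

Definition in_prop_ring x (Ox : O x) : prop_ring := exist _ x (asboolT Ox).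

Lemma prop_ringP (x : prop_ring) : O (val x).
Proof. by case: x => x /= /asboolP. Qed.

End SubringType.

Section IntegerRing.

Variables (R : realType) (p : nat) (Qp : fieldType) (v : Qp -> R).
Hypothesis Qp_padic : is_padic_field p v.

Lemma padic_val0 : v 0 = 0.
Proof.
have := padic_rat Qp_padic 0; rewrite /ratr mul0r => ->.
by rewrite /padic_abs eqxx.
Qed.

Lemma padic_val1 : v 1 = 1.
Proof.
have := padic_rat Qp_padic 1; rewrite /ratr divr1 => ->.
by rewrite /padic_abs oner_eq0 /= logn1.
Qed.

Lemma padic_valN x : v (- x) = v x.
Proof.
rewrite -mulN1r (padic_mul Qp_padic).
have := padic_rat Qp_padic (- 1).
have -> : ratr (-1) = -1 :> Qp by rewrite /ratr numqN denqN /= rmorphN divr1.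
by move=> ->; rewrite /padic_abs oppr_eq0 oner_eq0 numqN denqN /= logn1 mul1r.
Qed.

Lemma padic_val_ge0 x : 0 <= v x.
Proof.
have := padic_add Qp_padic x (- x).
by rewrite subrr padic_val0 padic_valN maxxx.
Qed.

Lemma padic_val_subring : subring_prop (fun x => v x <= 1).
Proof.
split=> [|x y vx vy|x y vx vy]; first by rewrite padic_val1.
  apply: le_trans (padic_add Qp_padic _ _) _.
  by rewrite padic_valN ge_max vx.
by rewrite (padic_mul Qp_padic) mulr_ile1 ?padic_val_ge0.
Qed.

(** With the valuation ring packaged as a ring type, [int_ring] becomes integrality over it, whose
    closure under ring operations is available. *)
Lemma int_ringP (L : fieldType) (i : {rmorphism Qp -> L}) x :
  int_ring v i x <->
  integralOver (i \o (val : prop_ring padic_val_subring -> Qp)) x.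
Proof.
split=> [[P [monP leP rootP]] | [P monP rootP]].
  pose Q := \poly_(k < size P) in_prop_ring padic_val_subring (leP k).
  have mapQ : map_poly val Q = P.
    apply/polyP => k; rewrite coef_map coef_poly; case: ltnP => //= ge_k.
    by rewrite nth_default.
  exists Q; last by rewrite map_poly_comp mapQ.
  apply/monicP/val_inj; rewrite -(lead_coef_map_inj val_inj (rmorph0 _)) mapQ.
  exact/monicP.
exists (map_poly val P); split.
- by rewrite monic_map.
- by move=> k; rewrite coef_map; apply: (prop_ringP P`_k).
by rewrite -map_poly_comp.
Qed.

Lemma int_ring_subring (L : fieldType) (i : {rmorphism Qp -> L}) :
  subring_prop (int_ring v i).
Proof.
split=> [|x y /(int_ringP i _).1 Ox /(int_ringP i _).1 Oy
  |x y /(int_ringP i _).1 Ox /(int_ringP i _).1 Oy].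
- by apply: (int_ringP i _).2; apply: integral1.
- by apply: (int_ringP i _).2; apply: integral_sub.
by apply: (int_ringP i _).2; apply: integral_mul.
Qed.

End IntegerRing.

Section Residue.

Variables (L k : fieldType) (O : L -> Prop) (OP : subring_prop O) (r : L -> k).
Hypothesis rP : is_residue_map O r.
Local Notation A := (prop_ring OP).

Lemma residueB x y : O x -> O y -> r (x - y) = r x - r y.
Proof.
have [_ OB _] := OP => Ox Oy; apply/eqP; rewrite -subr_eq opprK; apply/eqP.
by rewrite -(residueD rP) ?subrK //; apply: OB.
Qed.

Definition residue of is_residue_map O r := fun x : A => r (val x).

Lemma residue_is_zmod_morphism : zmod_morphism (residue rP).
Proof.
by move=> x y; rewrite /residue rmorphB residueB //; apply: prop_ringP.
Qed.

Lemma residue_is_monoid_morphism : monoid_morphism (residue rP).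
Proof.
split; first exact: (residue1 rP).
by move=> x y; apply: (residueM rP); apply: prop_ringP.
Qed.

HB.instance Definition _ :=
  GRing.isZmodMorphism.Build A k (residue rP) residue_is_zmod_morphism.
HB.instance Definition _ :=
  GRing.isMonoidMorphism.Build A k (residue rP) residue_is_monoid_morphism.

Lemma lift_mx m n (M : 'M[L]_(m, n)) :
  (forall a b, O (M a b)) -> exists N : 'M[A]_(m, n), M = map_mx val N.
Proof.
move=> OM; exists (\matrix_(a, b) in_prop_ring OP (OM a b)).
by apply/matrixP => a b; rewrite !mxE.
Qed.

Lemma map_mx_residue m n (N : 'M[A]_(m, n)) :
  map_mx r (map_mx val N) = map_mx (residue rP) N.
Proof. by apply/matrixP => a b; rewrite !mxE. Qed.

(** Lifted to the ring [A], the matrices already have equal characteristic polynomials there,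
    because [A] embeds in [L]; on [A] the map [r] is a ring morphism. *)
Lemma residue_char_poly n (M M' : 'M[L]_n) :
  (forall a b, O (M a b)) -> (forall a b, O (M' a b)) ->
  char_poly M = char_poly M' ->
  char_poly (map_mx r M) = char_poly (map_mx r M').
Proof.
move=> /lift_mx[N ->] /lift_mx[N' ->].
rewrite !map_mx_residue -!map_char_poly => eqNN'.
by rewrite (map_inj_poly val_inj (rmorph0 _) eqNN').
Qed.

Lemma residue_det n (M : 'M[L]_n) :
  (forall a b, O (M a b)) -> O (\det M) /\ r (\det M) = \det (map_mx r M).
Proof.
move=> /lift_mx[N ->]; rewrite map_mx_residue !det_map_mx.
by split; first exact: prop_ringP.
Qed.

Lemma residue_prod (I : finType) (F : I -> L) : (forall s, O (F s)) ->
  O (\prod_s F s) /\ r (\prod_s F s) = \prod_s r (F s).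
Proof.
move=> OF; pose F' s := in_prop_ring OP (OF s).
have -> : \prod_s F s = val (\prod_s F' s) by rewrite rmorph_prod.
split; first exact: prop_ringP.
by rewrite -[LHS]/(residue rP _) rmorph_prod.
Qed.

Lemma residueV x : O x -> O x^-1 -> x != 0 -> r x^-1 = (r x)^-1.
Proof.
move=> Ox Oxi x_neq0; have := residueM rP Ox Oxi.
rewrite divff // (residue1 rP) => rx.
have rx0 : r x != 0 by apply: contra_eq_neq rx => ->; rewrite mul0r oner_eq0.
by apply: (mulfI rx0); rewrite -rx divff.
Qed.

Lemma residue_exp x (m : int) : O x -> O x^-1 -> x != 0 ->
  O (x ^ m) /\ r (x ^ m) = r x ^ m.
Proof.
move=> Ox Oxi x_neq0.
have expn y l : O y -> O (y ^+ l) /\ r (y ^+ l) = r y ^+ l.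
  move=> Oy; rewrite -[y]/(val (in_prop_ring OP Oy)) -rmorphXn.
  by split; [apply: prop_ringP | rewrite -[LHS]/(residue rP _) rmorphXn].
case: m => l; first by rewrite -!exprnP; apply: expn.
rewrite NegzE -!exprnN -!exprVn -residueV //; exact: expn.
Qed.

Lemma residue_symm_mx n (g : 'M[L]_2) : (forall a b, O (g a b)) ->
  forall a b, O (symm_mx n g a b) /\
    r (symm_mx n g a b) = symm_mx n (map_mx r g) a b.
Proof.
move=> /lift_mx[N ->] a b; rewrite map_mx_residue !mxE.
pose lin c d : {poly A} := c%:P + d%:P * 'X.
pose P := lin (N 0 0) (N 0 1) ^+ (n - a) * lin (N 1 0) (N 1 1) ^+ a.
have mapP (B : comNzRingType) (f : {rmorphism A -> B}) :
    ((((f (N 0 0))%:P + (f (N 0 1))%:P * 'X) ^+ (n - a)) *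
    (((f (N 1 0))%:P + (f (N 1 1))%:P * 'X) ^+ a))`_b = f P`_b.
  rewrite -coef_map; congr (_`_b).
  rewrite rmorphM !rmorphXn !rmorphD !rmorphM /= !map_polyC map_polyX //.
rewrite (mapP _ (val : {rmorphism A -> L})) (mapP _ (residue rP)).
by split; first exact: prop_ringP.
Qed.

Lemma residue_unit x : O x -> r x != 0 -> x != 0 /\ O x^-1.
Proof.
move=> Ox /eqP rx; have [_ rker] := residue_ker rP Ox.
split; first by apply: contra_notN rx => /eqP x0; apply: rker; left.
by apply: contra_notP rx => nOx; apply: rker; right.
Qed.

Lemma residue0_nonunit x : O x -> x != 0 -> O x^-1 -> r x != 0.
Proof.
move=> Ox /eqP x_neq0 Oxi; apply/eqP => rx.
by have [/(_ rx)[]] := residue_ker rP Ox.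
Qed.

End Residue.

Section Reduction.

Variables (R : realType) (p : nat) (Qp : fieldType) (v : Qp -> R).
Hypothesis Qp_padic : is_padic_field p v.

Lemma int_ring_embedding (K L : fieldType) (i : {rmorphism Qp -> K})
    (iL : {rmorphism Qp -> L}) (tau : {rmorphism K -> L}) x :
  (forall a, tau (i a) = iL a) ->
  int_ring v iL (tau x) <-> int_ring v i x.
Proof.
move=> tau_i.
have map_tau P : map_poly iL P = map_poly tau (map_poly i P).
  by rewrite -map_poly_comp; apply: eq_map_poly => a /=; rewrite tau_i.
split=> -[P [monP leP rootP]]; exists P; split=> //.
  by move: rootP; rewrite map_tau fmorph_root.
by rewrite map_tau fmorph_root.
Qed.

(** An inverse is integral in [K] if and only if its image is integral in [L], so [tau] sends
    nonunits to nonunits. Hence [redE (tau x)] depends only on the residue of [x], and [sigma] can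
    be defined through arbitrary lifts. *)
Lemma residue_embedding (K L k E : fieldType) (i : {rmorphism Qp -> K})
    (iL : {rmorphism Qp -> L}) (tau : {rmorphism K -> L})
    (redK : K -> k) (redE : L -> E) :
  (forall a, tau (i a) = iL a) ->
  is_residue_map (int_ring v i) redK -> is_residue_map (int_ring v iL) redE ->
  exists sigma : {rmorphism k -> E},
    forall x, int_ring v i x -> redE (tau x) = sigma (redK x).
Proof.
move=> tau_i redKP redEP.
have OKP := int_ring_subring Qp_padic i.
have OLP := int_ring_subring Qp_padic iL.
have tauO x := int_ring_embedding x tau_i.
have [OK1 OKB OKM] := OKP.
have lift_ex y : exists x, int_ring v i x /\ redK x = y := residue_surj redKP y.
pose lift y := sval (cid (lift_ex y)).
have liftO y : int_ring v i (lift y) by rewrite /lift; case: cid => x [].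
have liftK y : redK (lift y) = y by rewrite /lift; case: cid => x [].
have redB x y := residueB OKP redKP (x := x) (y := y).
have redEB x y := residueB OLP redEP (x := x) (y := y).
pose sigma y := redE (tau (lift y)).
have sigmaE x : int_ring v i x -> redE (tau x) = sigma (redK x).
  move=> Ox; apply/eqP; rewrite -subr_eq0; set y := redK x.
  have Ox' := liftO y; have OB := OKB _ _ Ox Ox'.
  have red0 : redK (x - lift y) = 0.
    by rewrite redB // liftK subrr.
  rewrite -redEB ?tauO // -rmorphB.
  have [->|B_neq0] := eqVneq (x - lift y) 0.
    by rewrite rmorph0 -(subrr 1) redEB ?subrr //; case: OLP.
  apply/eqP; apply: contrapT => /eqP redE_neq0.
  have [_] := residue_unit redEP ((tauO _).2 OB) redE_neq0.
  rewrite -fmorphV tauO => OBi.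
  by have := residue0_nonunit redKP OB B_neq0 OBi; rewrite red0 eqxx.
have sigma_zmod : zmod_morphism sigma.
  move=> x y; rewrite -{1}[x]liftK -{1}[y]liftK.
  rewrite -redB // -sigmaE; last exact: OKB.
  by rewrite rmorphB redEB ?tauO.
have sigma_monoid : monoid_morphism sigma.
  split=> [|x y].
    rewrite -(residue1 redKP) -sigmaE ?rmorph1; first exact: residue1 redEP.
    by have [] := OKP.
  rewrite -{1}[x]liftK -{1}[y]liftK -(residueM redKP) // -sigmaE;
    last exact: OKM.
  by rewrite rmorphM (residueM redEP) //; apply/tauO.
pose s1 := GRing.isZmodMorphism.Build _ _ sigma sigma_zmod.
pose s2 := GRing.isMonoidMorphism.Build _ _ sigma sigma_monoid.
pose s : {rmorphism k -> E} := HB.pack sigma s1 s2.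
by exists s.
Qed.

Variables (K : fieldExtType Qp) (F : finFieldType) (redK : K -> F).
Hypothesis redKP : is_residue_map (int_ring v (in_alg K)) redK.
Variables (L : fieldType) (iota : {rmorphism Qp -> L}).
Variables (E : closedFieldType) (redE : L -> E).
Hypothesis redEP : is_residue_map (int_ring v iota) redE.
Variables (J : finType) (tau : J -> {rmorphism K -> L}).
Hypothesis tau_iota : forall s a, tau s a%:A = iota a.
Variable sigma : J -> {rmorphism F -> E}.
Hypothesis sigmaP :
  forall s x, int_ring v (in_alg K) x -> redE (tau s x) = sigma s (redK x).

Local Notation OK := (int_ring v (in_alg K)).
Local Notation OL := (int_ring v iota).
Let OKP : subring_prop OK := int_ring_subring Qp_padic (in_alg K).
Let OLP : subring_prop OL := int_ring_subring Qp_padic iota.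

Lemma GL2_int_lift (gF : {'GL_2[F]}) :
  exists g : 'M[K]_2, GL2_int OK g /\ GLval gF = map_mx redK g.
Proof.
have lift_ex y : exists x, OK x /\ redK x = y := residue_surj redKP y.
pose g : 'M[K]_2 := \matrix_(a, b) sval (cid (lift_ex (GLval gF a b))).
have Og a b : OK (g a b) by rewrite mxE; case: cid => x [].
have red_g : GLval gF = map_mx redK g.
  by apply/matrixP => a b; rewrite !mxE; case: cid => x [].
have [Odet red_det] := residue_det OKP redKP Og.
have det_neq0 : redK (\det g) != 0.
  by rewrite red_det -red_g -unitfE -unitmxE; apply: (valP gF).
by have [? ?] := residue_unit redKP Odet det_neq0; exists g.
Qed.

(** The action on the reduction of the standard lattice, the one spanned by [alg_basis]: each
    embedding [tau s] of [K] is replaced by the embedding [sigma s] of residue fields. *)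
Definition reduction_mx (n : J -> nat) (m : J -> int) (gF : {'GL_2[F]}) :
    'M[E]_#|alg_basis n| :=
  tensor_mx (fun s => \det (map_mx (sigma s) (GLval gF)) ^ m s *:
    symm_mx (n s) (map_mx (sigma s) (GLval gF))).

Lemma alg_repr_reduction n m (g : 'M[K]_2) (gF : {'GL_2[F]}) :
  GL2_int OK g -> GLval gF = map_mx redK g ->
  (forall a b, OL (alg_repr tau n m g a b)) /\
  map_mx redE (alg_repr tau n m g) = reduction_mx n m gF.
Proof.
move=> [Og det_neq0 Odeti] red_g.
have tauO s x : OL (tau s x) <-> OK x.
  by apply: (@int_ring_embedding K L (in_alg K) iota) => a; apply: tau_iota.
have Ogs s a b : OL (map_mx (tau s) g a b) by rewrite mxE; apply/tauO.
have red_gs s : map_mx redE (map_mx (tau s) g) = map_mx (sigma s) (GLval gF).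
  by apply/matrixP => a b; rewrite red_g !mxE sigmaP.
pose x (s : J) a b := symm_mx (n s) (map_mx (tau s) g) a b *
  \det (map_mx (tau s) g) ^ m s.
have ent s a b : OL (x s a b) /\
    redE (x s a b) = (\det (map_mx (sigma s) (GLval gF)) ^ m s *:
      symm_mx (n s) (map_mx (sigma s) (GLval gF))) a b.
  have [Osym redsym] := residue_symm_mx OLP redEP (Ogs s) a b.
  have [Odet reddet] := residue_det OLP redEP (Ogs s).
  have [||Oexp redexp] := @residue_exp _ _ _ OLP _ redEP _ (m s) Odet.
  - by rewrite det_map_mx -fmorphV tauO.
  - by rewrite det_map_mx fmorph_eq0.
  have [_ _ OLM] := OLP.
  split; first exact: OLM.
  by rewrite (residueM redEP) // redsym redexp reddet !red_gs [RHS]mxE mulrC.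
pose y (a b : 'I_#|alg_basis n|) s :=
  x s ((enum_val a : alg_basis n) s) ((enum_val b : alg_basis n) s).
have ent_ab a b := residue_prod OLP redEP (F := y a b) (fun s => (ent s _ _).1).
split=> [a b|]; first by rewrite mxE; have [] := ent_ab a b.
apply/matrixP => a b; rewrite !mxE; have [_ ->] := ent_ab a b.
by apply: eq_bigr => s _; have [_ ->] := ent s ((enum_val a : alg_basis n) s)
  ((enum_val b : alg_basis n) s).
Qed.

Lemma reduction_char_poly n m u (U : mx_representation E 'GL_2[F] u) :
  is_reduction OK redK OL redE R (alg_repr tau n m) U ->
  u = #|alg_basis n| /\
  forall gF : {'GL_2[F]}, char_poly (U gF) = char_poly (reduction_mx n m gF).
Proof.
case=> P [U0 [[uP stabP] [_ [A [B [blk [uA uB gr]]]]] eq_class]].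
split; first exact: rep_class_dim eq_class.
move=> gF; rewrite (rep_class_char_poly eq_class) ?inE //.
have [g [int_g red_g]] := GL2_int_lift gF.
have [Orep <-] := alg_repr_reduction n m int_g red_g.
rewrite -(char_poly_conj (U0 gF) uB).
(* Independence of the lattice: the actions on [P] and on the standard lattice are conjugate over
   [L] and both integral, so their characteristic polynomials agree before and therefore after
   reduction. *)
set M := map_mx redE _; rewrite -[RHS](_ : char_poly
  (lattice_reduction redE (alg_repr tau n m) P g) = _); last first.
  apply: (residue_char_poly OLP redEP) => //; first exact: stabP.
  exact: char_poly_conj.
(* Passing to the graded representation of the filtration [blk] keeps only the diagonal blocks. *)
rewrite -[RHS](char_poly_conj _ uA) [RHS](@char_poly_block_trig _ _ _ blk).
  congr char_poly; apply/matrixP => a b; rewrite [RHS]mxE.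
  by have [_ ->] := gr g gF int_g red_g a b.
by move=> a b lt_ab; have [-> //] := gr g gF int_g red_g a b.
Qed.

End Reduction.

(** * Eigenvalues in GL_2(F_q) *)

Section EigenvaluesOfRepresentations.

Variables (E : closedFieldType) (gT : finGroupType) (G : {group gT}).
Variables (n : nat) (V : mx_representation E G n).

Lemma repr_eigenvector x e k (u : 'rV[E]_n) :
  x \in G -> u *m V x = e *: u -> u *m V (x ^+ k)%g = e ^+ k *: u.
Proof.
move=> Gx uV; elim: k => [|k IHk]; first by rewrite repr_mx1 mulmx1 scale1r.
by rewrite expgSr repr_mxM ?groupX // mulmxA IHk -scalemxAl uV scalerA -exprSr.
Qed.

Lemma repr_eig_scalar x e k c :
  x \in G -> V (x ^+ k)%g = c%:M -> e \in eigs (V x) -> e ^+ k = c.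
Proof.
move=> Gx Vk; rewrite mem_eigs -eigenvalue_root_char.
case/eigenvalueP => u uV u_neq0.
have := repr_eigenvector k Gx uV; rewrite Vk mul_mx_scalar => /eqP.
by rewrite -subr_eq0 -scalerBl scaler_eq0 (negPf u_neq0) orbF subr_eq0 => /eqP.
Qed.

Lemma repr_eig_torsion x e : x \in G -> e \in eigs (V x) -> e ^+ #|G| = 1.
Proof.
by move=> Gx; apply: repr_eig_scalar => //; rewrite expg_cardG // repr_mx1.
Qed.

End EigenvaluesOfRepresentations.

Section GL2.

Variable F : finFieldType.
Implicit Types (g z : {'GL_2[F]}).
Local Notation G := 'GL_2[F]%G.
Local Notation Z := 'Z('GL_2[F])%g.

Lemma GL2_centerP z : reflect (exists c, GLval z = c%:M) (z \in Z).
Proof.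
apply: (iffP idP) => [/centerP[_ cz] | [c zc]]; last first.
  apply/centerP; split; first by rewrite inE.
  move=> g _; apply: val_inj; rewrite -[LHS]/(GLval (z * g)%g).
  by rewrite -[RHS]/(GLval (g * z)%g) !GL_MxE zc scalar_mxC.
have comm_z (M : 'M[F]_2) : M \in unitmx -> GLval z *m M = M *m GLval z.
  move=> uM; pose g : {'GL_2[F]} := FinRing.unit _ (uM : M \is a GRing.unit).
  by have /(congr1 (@GLval 2 F)) := cz g (in_setT g); rewrite !GL_MxE.
(* A central element commutes with the transvections 1 + E_ab, hence with the matrix units E_ab off
   the diagonal. *)
have comm01 (a b : 'I_2) : a != b ->
    GLval z *m delta_mx a b = delta_mx a b *m GLval z.
  move=> neq_ab; have := comm_z (1%:M + delta_mx a b).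
  rewrite mulmxDr mulmxDl mulmx1 mul1mx => h; apply: addrI; apply: h.
  suff /mulmx1_unit[u1 _] : 
      (1%:M + delta_mx a b) *m (1%:M - delta_mx a b) = 1%:M :> 'M[F]_2.
    exact: u1.
  rewrite mulmxBr mulmx1 mulmxDl mul1mx mul_delta_mx_0 1?eq_sym //.
  by rewrite addr0 addrK.
have ent (a b i k : 'I_2) : a != b ->
    GLval z i a * (k == b)%:R = (i == a)%:R * GLval z b k.
  move=> /comm01/matrixP/(_ i k); rewrite !mxE (bigD1 a) //= mxE eqxx andTb.
  rewrite big1 ?addr0 => [->|l /negPf nl]; last by rewrite mxE nl andFb mulr0.
  rewrite (bigD1 b) //= mxE eqxx andbT big1 ?addr0 // => l /negPf nl.
  by rewrite mxE nl andbF mul0r.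
exists (GLval z 0 0); apply/matrixP => i k; rewrite mxE.
have e01 := ent 0 1; have e10 := ent 1 0.
have := e01 1 1 isT; have := e10 0 0 isT; have := e01 0 1 isT.
rewrite /= !mulr1 !mul0r !mul1r => z00 z01 z10.
case: i => [[|[|//]] lt_i]; case: k => [[|[|//]] lt_k].
- by congr (GLval z _ _); apply: val_inj.
- by rewrite mulr0n -z01; congr (GLval z _ _); apply: val_inj.
- by rewrite mulr0n -z10; congr (GLval z _ _); apply: val_inj.
by rewrite mulr1n z00; congr (GLval z _ _); apply: val_inj.
Qed.

Section Embedding.

Variables (E : closedFieldType) (sigma : {rmorphism F -> E}).

Definition std_repr : mx_representation E G 2 := map_repr sigma (GLrepr F 1).

Lemma std_reprE g : std_repr g = map_mx sigma (GLval g).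
Proof. by []. Qed.

Lemma std_repr_scalar g c : std_repr g = c%:M -> g \in Z.
Proof.
rewrite std_reprE => /matrixP gc; apply/GL2_centerP.
exists (GLval g 0 0); apply/matrixP => i k; rewrite mxE.
have [<-|neq_ik] := eqVneq i k.
  apply: (fmorph_inj sigma); have := gc i i; have := gc 0 0.
  by rewrite !mxE !eqxx => -> ->.
apply: (fmorph_inj sigma); have := gc i k.
by rewrite !mxE (negPf neq_ik) rmorph0.
Qed.

Lemma eigs2 (A : 'M[E]_2) : exists a b, eigs A = [:: a; b] /\ \det A = a * b.
Proof.
have := size_eigs A; have := eigsE A; have := char_poly_det A.
case: (eigs A) => [|a [|b [|//]]] // detA cpA _; exists a, b; split=> //.
move: detA; rewrite cpA big_cons big_seq1 sqrrN expr1n mul1r => <-.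
by rewrite -horner_coef0 hornerM !hornerXsubC !sub0r mulrNN.
Qed.

End Embedding.

(* The exponent o is the order of [g] modulo the center. When the eigenvalues a
   and b are distinct their ratio has order o; otherwise o is 1 or p. *)
Lemma GL2_eig_ratio p (E : closedFieldType) g : p \in [pchar E] ->
  exists o, [/\ (0 < o)%N, (g ^+ o)%g \in Z &
    forall (sigma : {rmorphism F -> E}) a b,
      eigs (std_repr sigma g) = [:: a; b] ->
      (b / a) ^+ o = 1 /\ forall y, y ^+ o = 1 -> exists k, y = (b / a) ^+ k].
Proof.
move=> pE; have gN : g \in 'N(Z)%g.
  by apply: (subsetP (normal_norm (center_normal _))); rewrite inE.
pose o := #[coset Z g]%g; exists o.
have oE k : ((g ^+ k)%g \in Z) = (o %| k)%N.
  rewrite order_dvdn -morphX //; apply/idP/eqP => [/coset_id // | ].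
  by move/coset_idr; apply; apply: groupX.
split=> [||sigma a b eig_ab]; [exact: order_gt0 | by rewrite oE |].
have cp : char_poly (std_repr sigma g) = ('X - a%:P) * ('X - b%:P).
  by rewrite eigsE eig_ab big_cons big_seq1.
(* By Cayley-Hamilton, such a divisibility makes the k-th power of [g] scalar, hence central. *)
have scalar_dvd k c : char_poly (std_repr sigma g) %| 'X^k - c%:P -> (o %| k)%N.
  case/dvdpP => q def_q; rewrite -oE; apply: (@std_repr_scalar _ sigma _ c).
  have := congr1 (horner_mx (std_repr sigma g)) def_q.
  rewrite rmorphM /= Cayley_Hamilton mulr0 rmorphB rmorphXn /= horner_mx_X.
  rewrite horner_mx_C => /eqP; rewrite subr_eq0 => /eqP <-.
  by rewrite repr_mxX ?inE.
have eig_o e k : e \in [:: a; b] -> (o %| k)%N ->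
    e ^+ k = sigma (GLval (g ^+ k)%g 0 0).
  rewrite -eig_ab => eig_e; rewrite -oE => /GL2_centerP[c gk].
  apply: (repr_eig_scalar _ _ eig_e); first by rewrite inE.
  by rewrite std_reprE gk map_scalar_mx mxE eqxx.
have a_neq0 : a != 0.
  have : a ^+ #|G| = 1.
    apply: (@repr_eig_torsion _ _ G _ (std_repr sigma) g); rewrite ?inE //.
    by rewrite eig_ab mem_head.
  apply: contra_eq_neq => ->.
  by rewrite expr0n (gtn_eqF (cardG_gt0 _)) eq_sym oner_eq0.
have ab_o : (b / a) ^+ o = 1.
  rewrite expr_div_n (eig_o b) ?mem_seq2 ?eqxx ?orbT // -(eig_o a) ?mem_head //.
  by rewrite divff // expf_neq0.
split=> // y yo.
(* If a = b, the characteristic polynomial (X - a)^2 divides (X - a)^p = X^p - a^p, so o divides p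
   and the only o-th root of unity is 1. *)
have [eq_ab | neq_ab] := eqVneq a b.
  exists 0%N; rewrite expr0.
  have o_p : (o %| p)%N.
    apply: (scalar_dvd _ (a ^+ p)); rewrite cp -eq_ab.
    have pP : p \in [pchar {poly E}] by rewrite pchar_poly.
    have -> : 'X^p - (a ^+ p)%:P = ('X - a%:P) ^+ p.
      rewrite -[RHS](pFrobenius_autE pP) rmorphB /= !pFrobenius_autE.
      by rewrite polyC_exp.
    by rewrite -expr2 dvdp_exp2l // prime_gt1 // (pcharf_prime pE).
  have yp : y ^+ p = 1.
    by rewrite -(divnK o_p) mulnC exprM yo expr1n.
  by apply: (fmorph_inj (pFrobenius_aut pE)); rewrite rmorph1.
(* If m is the order of b/a, then a and b are distinct roots of X^m - a^m, so the characteristic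
   polynomial divides it and o divides m. *)
have z_prim : o.-primitive_root (b / a).
  have [m z_m m_o] := prim_order_exists (order_gt0 _ : 0 < o)%N ab_o.
  suff /eqP -> : o == m by [].
  rewrite eqn_dvd m_o andbT; apply: (scalar_dvd _ (a ^+ m)).
  rewrite cp; have := @uniq_roots_dvdp _ ('X^m - (a ^+ m)%:P) [:: a; b].
  rewrite big_cons big_seq1; apply.
    have := prim_expr_order z_m; rewrite expr_div_n => /divr1_eq bm.
    by rewrite /= !rootE !(hornerE, hornerXn) bm !subrr eqxx.
  by rewrite uniq_rootsE /= inE neq_ab.
by have [i ->] := prim_rootP z_prim yo; exists i.
Qed.

End GL2.

(** * Brauer characters of symmetric powers and of reductions *)

(** The complete homogeneous symmetric polynomial of degree n in two variables, that is, the trace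
    of Symm^n on a matrix with eigenvalues x and y. *)
Definition homog_sum (C : comNzRingType) n (x y : C) : C :=
  \sum_(i < n.+1) x ^+ (n - i) * y ^+ i.

Lemma homog_sumC (C : comNzRingType) n (x y : C) :
  homog_sum n x y = homog_sum n y x.
Proof.
rewrite /homog_sum (reindex_inj rev_ord_inj); apply: eq_bigr => i _.
by rewrite /= subSS subKn ?leq_ord // mulrC.
Qed.

Lemma homog_sum_diag (C : comNzRingType) n (x : C) :
  homog_sum n x x = x ^+ n *+ n.+1.
Proof.
rewrite /homog_sum -[in RHS](card_ord n.+1) -sumr_const.
by apply: eq_bigr => i _; rewrite -exprD subnK ?leq_ord.
Qed.

(** Multiplied by x - y, the sum becomes x^(n+1) - y^(n+1), which is periodic in n; cancelling
    requires x and y to be distinct. *)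
Lemma homog_sum_mod (x y : algC) N n n' :
  x ^+ N = 1 -> y ^+ N = 1 -> x != y -> n = n' %[mod N] ->
  homog_sum n x y = homog_sum n' x y.
Proof.
move=> xN yN neq_xy eq_n.
have expN (z : algC) k : z ^+ N = 1 -> z ^+ k = z ^+ (k %% N).
  by move=> zN; rewrite {1}(divn_eq k N) exprD mulnC exprM zN expr1n mul1r.
have neq0 : x - y != 0 by rewrite subr_eq0.
apply: (mulfI neq0); rewrite -!subrXX.
have eq_S : n.+1 = n'.+1 %[mod N] by rewrite -addn1 -modnDml eq_n modnDml addn1.
by rewrite (expN x n.+1) // (expN y n.+1) // eq_S -!expN.
Qed.

Section BrauerCharacters.

Variables (R : realType) (E : closedFieldType) (F : finFieldType) (p : nat).
Hypothesis pE : p \in [pchar E].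
Local Notation G := 'GL_2[F]%G.
Local Notation Z := 'Z('GL_2[F])%g.
Local Notation N := #|G|.
Implicit Types g : {'GL_2[F]}.

Variable chi : nat -> E -> algC.
Hypothesis chi1 : forall t, chi t 1 = 1.
Hypothesis chiM : forall t x y, x ^+ N = 1 -> y ^+ N = 1 ->
  chi t (x * y) = chi t x * chi t y.
Hypothesis chi_sep : forall s1 s2, (forall x, x \in s1 ++ s2 -> x ^+ N = 1) ->
  (forall t, \sum_(x <- s1) chi t x = \sum_(x <- s2) chi t x) -> perm_eq s1 s2.

Lemma chiX t x k : x ^+ N = 1 -> chi t (x ^+ k) = chi t x ^+ k.
Proof.
move=> xN; elim: k => [|k IHk]; first by rewrite chi1.
by rewrite !exprS chiM ?IHk // -exprM mulnC exprM xN expr1n.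
Qed.

Lemma chi_torsion t x : x ^+ N = 1 -> chi t x ^+ N = 1.
Proof. by move=> xN; rewrite -chiX // xN chi1. Qed.

Lemma chi_exprz t x (m : int) : x ^+ N = 1 -> chi t (x ^ m) = chi t x ^ m.
Proof.
move=> xN; case: m => k; first by rewrite -!exprnP chiX.
rewrite NegzE -!exprnN -!exprVn.
have xVN : x^-1 ^+ N = 1 by rewrite exprVn xN invr1.
rewrite chiX //; congr (_ ^+ _).
have x_neq0 : x != 0.
  apply: contra_eq_neq xN => ->.
  by rewrite expr0n (gtn_eqF (cardG_gt0 _)) eq_sym oner_eq0.
have := chiM t xN xVN; rewrite divff // chi1 => chiV.
have chi_neq0 : chi t x != 0.
  by apply: contra_eq_neq chiV => ->; rewrite mul0r oner_eq0.
by apply: (mulfI chi_neq0); rewrite -chiV divff.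
Qed.

Definition brauer_sum t n (A : 'M[E]_n) : algC := \sum_(x <- eigs A) chi t x.

Lemma brauer_sum_prod t g n1 n2 (V1 : mx_representation E G n1)
    (V2 : mx_representation E G n2) :
  brauer_sum t (prod_repr V1 V2 g) =
  brauer_sum t (V1 g) * brauer_sum t (V2 g).
Proof.
rewrite /brauer_sum big_eigs_tprod mulr_suml !big_seq.
apply: eq_bigr => x /repr_eig_torsion xN; rewrite mulr_sumr !big_seq.
by apply: eq_bigr => y /repr_eig_torsion yN; rewrite chiM ?xN ?yN ?inE.
Qed.

(** At each [g] separately, the sums for all [t] determine the multiset of eigenvalues by [chi_sep],
    hence the product of the characteristic polynomials. *)
Lemma brauer_sum_class (Vs1 Vs2 : seq (repr_obj E G)) :
  (forall t g, \sum_(V <- Vs1) brauer_sum t (projT2 V g) =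
               \sum_(V <- Vs2) brauer_sum t (projT2 V g)) ->
  \sum_(V <- Vs1) rep_class R (projT2 V) =
  \sum_(V <- Vs2) rep_class R (projT2 V).
Proof.
move=> eq_sum; apply: (brauer_nesbitt _ pE) => g Gg.
pose eigs_seq Vs := flatten [seq eigs (projT2 V g) | V : repr_obj E G <- Vs].
have eigs_seq_tors Vs x : x \in eigs_seq Vs -> x ^+ N = 1.
  elim: Vs => //= V Vs IH; rewrite mem_cat => /orP[|]; last exact: IH.
  exact: repr_eig_torsion.
have prodE (Vs : seq (repr_obj E G)) : \prod_(V <- Vs) char_poly (projT2 V g) =
    \prod_(x <- eigs_seq Vs) ('X - x%:P).
  by rewrite big_flatten big_map; apply: eq_bigr => V _; rewrite eigsE.
rewrite !prodE; apply/perm_big/chi_sep => [x|t].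
  by rewrite mem_cat => /orP[] /eigs_seq_tors.
by rewrite !big_flatten !big_map; apply: eq_sum.
Qed.

(** Triangularization may exchange the two eigenvalues with respect to the order in [eigs];
    [homog_sum] is symmetric, so this is harmless. *)
Lemma chi_homog_sum t (A : 'M[E]_2) a b n : eigs A = [:: a; b] ->
  exists P, [/\ P \in unitmx, is_trig_mx (P *m A *m invmx P) &
    let T := P *m A *m invmx P in
    homog_sum n (chi t (T 0 0)) (chi t (T 1 1)) =
    homog_sum n (chi t a) (chi t b)].
Proof.
move=> eig_ab; have [P uP trigP] := trig_similar A; exists P; split=> //=.
have := eigs_similar uP trigP; rewrite eig_ab.
set T := P *m A *m invmx P.
have -> : enum 'I_2 = [:: 0; 1].
  by apply: (inj_map val_inj); rewrite val_enum_ord.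
rewrite /=.
have [-> | neq] := eqVneq a (T 0 0).
  by rewrite perm_cons => /perm_mem/(_ b); rewrite !inE eqxx => /esym/eqP ->.
move=> perm_ab; have := perm_mem perm_ab a; rewrite !inE eqxx (negPf neq) /=.
move=> /esym/eqP a1; move: perm_ab.
rewrite -a1 perm_sym -[[:: T 0 0; a]]/([:: T 0 0] ++ [:: a]).
rewrite perm_catC perm_cons => /perm_mem/(_ b).
by rewrite !inE eqxx => /eqP ->; rewrite homog_sumC.
Qed.

Lemma std_eig_torsion (sigma : {rmorphism F -> E}) g x :
  x \in eigs (std_repr sigma g) -> x ^+ N = 1.
Proof. by apply: repr_eig_torsion; rewrite inE. Qed.

Lemma torsionX k (x : E) : x ^+ N = 1 -> (x ^+ k) ^+ N = 1.
Proof. by move=> xN; rewrite -exprM mulnC exprM xN expr1n. Qed.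

Lemma torsionM (x y : E) : x ^+ N = 1 -> y ^+ N = 1 -> (x * y) ^+ N = 1.
Proof. by move=> xN yN; rewrite exprMn xN yN mulr1. Qed.

Lemma chi_prod (I : finType) t (f : I -> E) : (forall s, f s ^+ N = 1) ->
  chi t (\prod_s f s) = \prod_s chi t (f s).
Proof.
move=> fN.
suff [] : (\prod_s f s) ^+ N = 1 /\
    chi t (\prod_s f s) = \prod_s chi t (f s) by [].
elim/big_rec2: _ => [|s y x _ [xN chix]]; first by rewrite expr1n chi1.
by rewrite torsionM // chiM // chix.
Qed.

Lemma std_diag_torsion (sigma : {rmorphism F -> E}) g P i : P \in unitmx ->
  is_trig_mx (P *m std_repr sigma g *m invmx P) ->
  (P *m std_repr sigma g *m invmx P) i i ^+ N = 1.
Proof.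
move=> uP trigP; apply: (@std_eig_torsion sigma g).
rewrite (perm_mem (eigs_similar uP trigP)).
by apply/mapP; exists i; rewrite ?mem_enum.
Qed.

Lemma brauer_sum_symm t g (sigma : {rmorphism F -> E}) a b n :
  eigs (std_repr sigma g) = [:: a; b] ->
  brauer_sum t (symm_mx n (std_repr sigma g)) =
  homog_sum n (chi t a) (chi t b).
Proof.
move=> eig_ab; have [P [uP trigP <-]] := chi_homog_sum t n eig_ab.
have PT i := std_diag_torsion i uP trigP.
set T := P *m _ *m _ in trigP PT *.
have symT : symm_mx n P *m symm_mx n (std_repr sigma g) *m invmx (symm_mx n P) =
    symm_mx n T by rewrite -symm_mxV // -!symm_mxM.
have trigS : is_trig_mx (symm_mx n P *m symm_mx n (std_repr sigma g) *m
    invmx (symm_mx n P)) by rewrite symT symm_mx_trig.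
rewrite /brauer_sum (big_eigs_similar _ (symm_mx_unit n uP) trigS) symT.
apply: eq_bigr => i _.
by rewrite symm_mx_trig_diag // chiM ?torsionX // !chiX.
Qed.

(** Triangularize the image of [g] under each embedding by [P s]. The tensor product of the matrices
    [symm_mx (n s) (P s)] then makes the reduction a tensor product of triangular matrices, and the
    sum over its diagonal factors by distributivity. *)
Lemma brauer_sum_reduction (J : finType) (sigma : J -> {rmorphism F -> E})
    (a b : J -> E) (n : J -> nat) (m : J -> int) t g :
  (forall s, eigs (std_repr (sigma s) g) = [:: a s; b s]) ->
  brauer_sum t (reduction_mx sigma n m g) =
  \prod_s (chi t (\det (std_repr (sigma s) g)) ^ m s *
           homog_sum (n s) (chi t (a s)) (chi t (b s))).
Proof.
move=> eig_ab.
have P_ s := cid (chi_homog_sum t (n s) (eig_ab s)).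
pose P s := sval (P_ s).
have uP s : P s \in unitmx by rewrite /P; case: (P_ s) => ? [].
pose A s := std_repr (sigma s) g.
pose T s := P s *m A s *m invmx (P s).
have trigP s : is_trig_mx (T s) by rewrite /T /P; case: (P_ s) => ? [].
have homT s : homog_sum (n s) (chi t (T s 0 0)) (chi t (T s 1 1)) =
    homog_sum (n s) (chi t (a s)) (chi t (b s)).
  by rewrite /T /P; case: (P_ s) => ? [].
have TN s i : T s i i ^+ N = 1 by apply: std_diag_torsion (uP s) (trigP s).
pose d s := \det (A s) ^ m s.
have detN s : \det (A s) ^+ N = 1.
  have -> : \det (A s) = \det (T s).
    by rewrite !det_mulmx mulrC mulrA -det_mulmx mulVmx // det1 mul1r.
  rewrite (det_trig (trigP s)) big_ord_recl big_ord1.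
  by rewrite torsionM.
have dN s : d s ^+ N = 1.
  rewrite /d; case: (m s) => k.
    by rewrite -exprnP torsionX.
  by rewrite NegzE -exprnN -exprVn torsionX // exprVn detN invr1.
pose Q s := symm_mx (n s) (P s).
have uQ s : Q s \in unitmx by apply: symm_mx_unit.
have QK : tensor_mx Q *m tensor_mx (fun s => invmx (Q s)) = 1%:M.
  rewrite -tensor_mxM -[RHS](tensor_mx1 E n); congr (tensor_mx _).
  by apply: functional_extensionality_dep => s; rewrite mulmxV.
have [uQt _] := mulmx1_unit QK.
have invQ : tensor_mx (fun s => invmx (Q s)) = invmx (tensor_mx Q).
  by rewrite -[LHS]mul1mx -(mulVmx uQt) -mulmxA QK mulmx1.
pose S s := d s *: symm_mx (n s) (T s).
have conj_red : tensor_mx Q *m reduction_mx sigma n m g *m invmx (tensor_mx Q) =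
    tensor_mx S.
  rewrite -invQ -!tensor_mxM; congr (tensor_mx _).
  apply: functional_extensionality_dep => s.
  by rewrite -scalemxAr -scalemxAl /Q -symm_mxV // -!symm_mxM.
have trigS s : is_trig_mx (S s).
  apply/is_trig_mxP => i k lt_ik; rewrite mxE.
  by rewrite (is_trig_mxP (symm_mx_trig (n s) (trigP s))) ?mulr0.
have perm_red : perm_eq (eigs (reduction_mx sigma n m g))
    [seq \prod_s S s (f s) (f s) | f : alg_basis n <- enum (alg_basis n)].
  apply: perm_eigs; rewrite -(char_poly_conj _ uQt) conj_red.
  by rewrite char_poly_tensor_trig // big_map big_enum.
rewrite /brauer_sum (perm_big _ perm_red) big_map big_enum /=.
pose c s (i : 'I_(n s).+1) := chi t (S s i i).
have SE s i : S s i i = d s * (T s 0 0 ^+ (n s - i) * T s 1 1 ^+ i).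
  by rewrite mxE symm_mx_trig_diag.
have SN s i : S s i i ^+ N = 1.
  by rewrite SE torsionM // torsionM // torsionX.
transitivity (\sum_(f : alg_basis n) \prod_s c s (f s)).
  by apply: eq_bigr => f _; rewrite chi_prod.
rewrite big_dffun_distr; apply: eq_bigr => s _.
rewrite -homT /homog_sum mulr_sumr; apply: eq_bigr => i _.
rewrite /c SE chiM ?torsionM ?torsionX // chiM ?torsionX // !chiX //.
by rewrite /d chi_exprz.
Qed.

End BrauerCharacters.

(** * The operator [Sym^N] - 1 on classes *)

Section SymmetricDefect.

Variables (R : realType) (E : closedFieldType) (F : finFieldType).
Variable j : {rmorphism F -> E}.
Local Notation G := 'GL_2[F]%G.
Local Notation Z := 'Z('GL_2[F])%g.
Local Notation N := #|G|.
Implicit Types (g z : {'GL_2[F]}).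

Lemma sym_mx_repr n : mx_repr G (fun g => symm_mx n (std_repr j g)).
Proof.
split=> [|x y Gx Gy]; first by rewrite repr_mx1 symm_mx1.
by rewrite repr_mxM // symm_mxM.
Qed.

Definition sym_repr n := MxRepresentation (sym_mx_repr n).

(** Its Brauer character is that of [V] multiplied by N where chi(a) = chi(b), and by 0
    elsewhere. *)
Definition sym_defect n (V : mx_representation E G n) : rep_group R E G :=
  rep_class R (prod_repr (sym_repr N) V) - rep_class R V.

Lemma sum_nseq (V : nmodType) (T : Type) (f : T -> V) k x :
  \sum_(y <- nseq k x) f y = f x *+ k.
Proof. by rewrite big_nseq iter_addr_0. Qed.

Section Lift.

Variable p : nat.
Hypothesis pE : p \in [pchar E].
Variable chi : nat -> E -> algC.
Hypothesis chi1 : forall t, chi t 1 = 1.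
Hypothesis chiM : forall t x y, x ^+ N = 1 -> y ^+ N = 1 ->
  chi t (x * y) = chi t x * chi t y.
Hypothesis chi_sep : forall s1 s2, (forall x, x \in s1 ++ s2 -> x ^+ N = 1) ->
  (forall t, \sum_(x <- s1) chi t x = \sum_(x <- s2) chi t x) -> perm_eq s1 s2.
Local Notation bsum t A := (brauer_sum chi t A).

Lemma std_eigs (sigma : {rmorphism F -> E}) g :
  exists a b, [/\ eigs (std_repr sigma g) = [:: a; b], a ^+ N = 1 & b ^+ N = 1].
Proof.
have [a [b [eig_ab _]]] := eigs2 (std_repr sigma g); exists a, b.
split=> //; apply: (@std_eig_torsion _ _ sigma g);
  by rewrite eig_ab !inE eqxx ?orbT.
Qed.

(** Both values come from x^N = 1: on the diagonal the sum is (N + 1) x^N, and off it degree N can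
    be replaced by degree 0. *)
Lemma brauer_sum_sym t g a b : eigs (std_repr j g) = [:: a; b] ->
  a ^+ N = 1 -> b ^+ N = 1 ->
  bsum t (sym_repr N g) = if chi t a == chi t b then N.+1%:R else 1.
Proof.
move=> eig_ab aN bN; rewrite (brauer_sum_symm chi1 chiM _ _ eig_ab).
have xN := chi_torsion chi1 chiM t aN; have yN := chi_torsion chi1 chiM t bN.
have [<- | neq] := eqVneq; first by rewrite homog_sum_diag xN.
rewrite (homog_sum_mod xN yN neq (_ : N = 0 %[mod N])) ?modnn ?mod0n //.
by rewrite /homog_sum big_ord1 mulr1.
Qed.

Lemma torsion_neq0 (x : E) : x ^+ N = 1 -> x != 0.
Proof.
apply: contra_eq_neq => ->.
by rewrite expr0n (gtn_eqF (cardG_gt0 _)) eq_sym oner_eq0.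
Qed.

Lemma chi_neq0 t x : x ^+ N = 1 -> chi t x != 0.
Proof.
move=> /(chi_torsion chi1 chiM t); apply: contra_eq_neq => ->.
by rewrite expr0n (gtn_eqF (cardG_gt0 _)) eq_sym oner_eq0.
Qed.

Lemma chi_div_eq1 t a b : a ^+ N = 1 -> b ^+ N = 1 -> chi t a = chi t b ->
  chi t (b / a) = 1.
Proof.
move=> aN bN eq_chi; apply: (mulIf (chi_neq0 t aN)).
rewrite -chiM ?divfK ?torsion_neq0 ?mul1r //.
by rewrite exprMn exprVn aN bN invr1 mulr1.
Qed.

(** The exponent o of [GL2_eig_ratio] does not depend on the embedding, so b/a is an o-th root of
    unity and thus a power of b'/a'. If chi is trivial on the latter, it is trivial on the
    former. *)
Lemma chi_ratio t (sigma : {rmorphism F -> E}) g a b a' b' :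
  eigs (std_repr j g) = [:: a; b] -> eigs (std_repr sigma g) = [:: a'; b'] ->
  chi t a' = chi t b' -> chi t a = chi t b.
Proof.
move=> eig_ab eig_ab' eq_chi.
have tors (s : {rmorphism F -> E}) x y :
    eigs (std_repr s g) = [:: x; y] -> x ^+ N = 1 /\ y ^+ N = 1.
  by move=> e; split; apply: (@std_eig_torsion _ _ s g);
    rewrite e !inE eqxx ?orbT.
have [aN bN] := tors _ _ _ eig_ab; have [aN' bN'] := tors _ _ _ eig_ab'.
have [o [_ _ ratio]] := GL2_eig_ratio g pE.
have [ab_o _] := ratio _ _ _ eig_ab.
have [_ /(_ _ ab_o)[k ab_k]] := ratio _ _ _ eig_ab'.
have divN (x y : E) : x ^+ N = 1 -> y ^+ N = 1 -> (x / y) ^+ N = 1.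
  by move=> xN yN; rewrite exprMn exprVn xN yN invr1 mulr1.
rewrite -[b](divfK (torsion_neq0 aN)) chiM ?divN // ab_k.
by rewrite (chiX chi1 chiM) ?divN // (chi_div_eq1 aN') // expr1n mul1r.
Qed.

Lemma brauer_sum_central t g a b n n' (V : mx_representation E G n)
    (V' : mx_representation E G n') :
  eigs (std_repr j g) = [:: a; b] -> chi t a = chi t b ->
  (forall z, z \in Z -> exists c, V z = c%:M /\ V' z = c%:M) ->
  n'%:R * bsum t (V g) = n%:R * bsum t (V' g).
Proof.
move=> eig_ab eq_chi cenV.
have tors x : x \in eigs (std_repr j g) -> x ^+ N = 1 by apply: std_eig_torsion.
have aN : a ^+ N = 1 by apply: tors; rewrite eig_ab mem_head.
have bN : b ^+ N = 1 by apply: tors; rewrite eig_ab !inE eqxx orbT.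
have [o [_ go ratio]] := GL2_eig_ratio g pE.
have [c [Vc V'c]] := cenV _ go.
have [_ ab_gen] := ratio _ _ _ eig_ab.
have eq_e e e' : e \in eigs (V g) -> e' \in eigs (V' g) -> chi t e = chi t e'.
  move=> eV eV'.
  have eN : e ^+ N = 1 by apply: repr_eig_torsion eV; rewrite inE.
  have eN' : e' ^+ N = 1 by apply: repr_eig_torsion eV'; rewrite inE.
  have eo : e ^+ o = c by apply: repr_eig_scalar Vc eV; rewrite inE.
  have eo' : e' ^+ o = c by apply: repr_eig_scalar V'c eV'; rewrite inE.
  have [|k def_k] := ab_gen (e / e').
    by rewrite expr_div_n eo -eo' divff ?expf_neq0 ?torsion_neq0.
  have divN (x y : E) : x ^+ N = 1 -> y ^+ N = 1 -> (x / y) ^+ N = 1.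
    by move=> xN yN; rewrite exprMn exprVn xN yN invr1 mulr1.
  rewrite -[e](divfK (torsion_neq0 eN')) chiM ?divN // def_k.
  by rewrite (chiX chi1 chiM) ?divN // (chi_div_eq1 aN) // expr1n mul1r.
(* Both sides become double sums over pairs of eigenvalues, compared term by term; this also covers
   empty lists. *)
have dbl (s s' : seq E) (f : E -> algC) :
    (size s')%:R * \sum_(e <- s) f e = \sum_(e <- s) \sum_(e' <- s') f e.
  rewrite mulr_sumr; apply: eq_bigr => e _.
  by rewrite big_const_seq count_predT iter_addr_0 mulr_natl.
rewrite -[in LHS](size_eigs (V' g)) -[in RHS](size_eigs (V g)) !dbl.
rewrite exchange_big /=.
rewrite !big_seq; apply: eq_bigr => e' e'V; rewrite !big_seq.
by apply: eq_bigr => e eV; apply: eq_e.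
Qed.

Lemma sym_defect_central n n' (V : mx_representation E G n)
    (V' : mx_representation E G n') :
  (forall z, z \in Z -> exists c, V z = c%:M /\ V' z = c%:M) ->
  n'%:R *: sym_defect V = n%:R *: sym_defect V'.
Proof.
move=> cenV.
pose O m (X : mx_representation E G m) : repr_obj E G := existT _ m X.
(* With negative terms moved across, the claim reads n'[Sym^N (x) V] + n[V'] = n[Sym^N (x) V'] +
   n'[V]. *)
have := @brauer_sum_class R E F p pE chi chi_sep
  (nseq n' (O _ (prod_repr (sym_repr N) V)) ++ nseq n (O _ V'))
  (nseq n (O _ (prod_repr (sym_repr N) V')) ++ nseq n' (O _ V)).
rewrite !big_cat !sum_nseq /O /= => eq_class.
rewrite /sym_defect !scalerBr !scaler_nat; apply/eqP.
rewrite subr_eq addrAC eq_sym subr_eq; apply/eqP/esym; apply: eq_class => t g.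
have projO m (X : mx_representation E G m) :
  bsum t (projT2 (O m X) g) = bsum t (X g) by [].
have prodO m (X : mx_representation E G m) :
    bsum t (projT2 (O _ (prod_repr (sym_repr N) X)) g) =
    bsum t (sym_repr N g) * bsum t (X g) by exact: brauer_sum_prod.
have [a [b [eig_ab aN bN]]] := std_eigs j g.
rewrite !big_cat !sum_nseq !prodO !projO (brauer_sum_sym t eig_ab aN bN) /=.
case: eqVneq => [eq_chi | _]; last by rewrite !mul1r addrC.
have := brauer_sum_central eig_ab eq_chi cenV.
rewrite !mulr_natl => eq_VV'.
by rewrite ![_ *+ N.+1 *+ _]mulrnAC eq_VV'.
Qed.

(** Each side is (N + 1)[V] - [Sym^N (x) V], whose Brauer character vanishes where chi(a) = chi(b);
    only the remaining pairs need to be compared. *)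
Lemma sym_defect_congruent n n' (V : mx_representation E G n)
    (V' : mx_representation E G n') :
  (forall t g a b, eigs (std_repr j g) = [:: a; b] -> chi t a != chi t b ->
     bsum t (V g) = bsum t (V' g)) ->
  N%:R *: rep_class R V - sym_defect V = N%:R *: rep_class R V' - sym_defect V'.
Proof.
move=> eqV.
pose O m (X : mx_representation E G m) : repr_obj E G := existT _ m X.
have := @brauer_sum_class R E F p pE chi chi_sep
  (O _ (prod_repr (sym_repr N) V') :: nseq N.+1 (O _ V))
  (O _ (prod_repr (sym_repr N) V) :: nseq N.+1 (O _ V')).
rewrite !big_cons !sum_nseq /O /= => eq_class.
rewrite /sym_defect !opprB !addrA !scaler_nat -!mulrSr; apply/eqP.
rewrite subr_eq addrAC eq_sym subr_eq; apply/eqP.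
rewrite [LHS]addrC [RHS]addrC !mulrS; apply/esym/eq_class => t g.
have projO m (X : mx_representation E G m) :
  bsum t (projT2 (O m X) g) = bsum t (X g) by [].
have prodO m (X : mx_representation E G m) :
    bsum t (projT2 (O _ (prod_repr (sym_repr N) X)) g) =
    bsum t (sym_repr N g) * bsum t (X g) by exact: brauer_sum_prod.
have [a [b [eig_ab aN bN]]] := std_eigs j g.
rewrite !big_cons !sum_nseq !prodO !projO (brauer_sum_sym t eig_ab aN bN) /=.
case: eqVneq => [_ | /(eqV _ _ _ _ eig_ab) -> //].
by rewrite !mulr_natl -!mulrS addrC.
Qed.

End Lift.
End SymmetricDefect.

(** * Central characters *)

Section CentralCharacters.

Variables (E : closedFieldType) (F : finFieldType) (j : {rmorphism F -> E}).
Local Notation G := 'GL_2[F]%G.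
Local Notation Z := 'Z('GL_2[F])%g.
Implicit Types (z : {'GL_2[F]}).

Lemma GL2_center_expg z : z \in Z -> (z ^+ #|F|)%g = z.
Proof.
move=> /GL2_centerP[c zc]; apply: val_inj.
have expE k : GLval (z ^+ k)%g = (c ^+ k)%:M.
  elim: k => [|k IHk]; first by rewrite expg0 GL_1E.
  by rewrite expgS GL_MxE zc IHk -scalar_mxM -exprS.
by rewrite -[LHS]/(GLval _) expE expf_card -zc.
Qed.

Lemma root_finField (x : E) : x ^+ #|F| = x -> exists y, x = j y.
Proof.
move=> xF; have := congr1 (fun q => (map_poly j q).[x]) (finField_genPoly F).
rewrite rmorphB /= map_polyXn map_polyX !(hornerE, hornerXn) xF subrr.
rewrite rmorph_prod horner_prod => /esym/eqP/prodf_eq0[y _].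
rewrite rmorphB /= map_polyX map_polyC !hornerE subr_eq0 => /eqP ->.
by exists y.
Qed.

(** Central elements satisfy z^q = z, so the scalars by which they act are roots of X^q - X and lie
    in the image of [j]. *)
Lemma central_char_exists n (V : mx_representation E G n) : (0 < n)%N ->
  (forall z, z \in Z -> exists c, V z = c%:M) ->
  exists a, has_central_char j V a.
Proof.
case: n V => // n V _ scalV.
have unit_ex (z : subg_of Z) :
    exists u : {unit F}, V (sgval z) = (j (val u))%:M.
  have Zz := subgP z; have [c Vz] := scalV _ Zz.
  have VzX k : V (sgval z ^+ k)%g = (c ^+ k)%:M.
    by rewrite repr_mxX ?inE // Vz -rmorphXn.
  have scal_inj := fmorph_inj (@scalar_mx E n.+1).
  have [y c_y] : exists y, c = j y.
    apply: root_finField; apply: scal_inj.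
    by rewrite /= -VzX GL2_center_expg.
  have y_unit : y \is a GRing.unit.
    rewrite unitfE -(fmorph_eq0 j) -c_y; apply/eqP => c0.
    have := repr_mx_unit V (in_setT (sgval z)).
    by rewrite Vz c0 rmorph0 unitmxE det0 unitr0.
  by exists (FinRing.unit _ y_unit); rewrite Vz c_y.
pose a0 x := sval (cid (unit_ex x)).
have a0P x : V (sgval x) = (j (val (a0 x)))%:M by rewrite /a0; case: cid.
have a_morph : morphic [set: subg_of Z] (finfun a0).
  apply/morphicP => x y _ _; rewrite !ffunE; apply: val_inj.
  apply: (fmorph_inj j); apply: (fmorph_inj (@scalar_mx E n.+1)) => /=.
  rewrite -a0P rmorphM /= repr_mxM ?inE // !a0P.
  by rewrite -scalar_mxM -rmorphM.
by exists (exist _ (finfun a0) a_morph) => x; rewrite ffunE a0P.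
Qed.

Lemma exprBn_pchar (x c : {poly E}) k : [pchar {poly E}].-nat k ->
  (x - c) ^+ k = x ^+ k - c ^+ k.
Proof.
move=> pk; apply/eqP; rewrite eq_sym subr_eq -exprDn_pchar //.
by rewrite subrK.
Qed.

(** A representation known only by its class has known characteristic polynomials, which do not rule
    out a nilpotent part. Since z is its own q-th power for arbitrarily large powers q of the
    cardinality of [F], V(z) = V(z)^q, and this is the scalar c^q once q is at least the
    dimension. *)
Lemma central_scalar n (V : mx_representation E G n) z c :
  z \in Z -> char_poly (V z) = ('X - c%:P) ^+ n -> exists d, V z = d%:M.
Proof.
case: n V => [|n] V Zz cpV.
  by exists 0; rewrite [LHS]flatmx0 [RHS]flatmx0.
have [p pr_p pF] := finPcharP F.
pose q := (#|F| ^ n.+1)%N.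
have q_nat : [pchar {poly E}].-nat q.
  rewrite pnatX /= orbF (card_pprimeChar pF) pnatX pnatE //.
  by rewrite pchar_poly (fmorph_pchar j) pF.
have zq k : (z ^+ (#|F| ^ k))%g = z.
  by elim: k => [|k IHk]; rewrite ?expg1 // expnS expgM GL2_center_expg.
have le_nq : (n.+1 <= q)%N by rewrite ltnW // ltn_expl // finNzRing_gt1.
exists (c ^+ q); rewrite -[in LHS](zq n.+1) repr_mxX ?inE //.
have : char_poly (V z) %| 'X^q - (c ^+ q)%:P.
  by rewrite cpV polyC_exp -exprBn_pchar // dvdp_exp2l.
case/dvdpP => Q /(congr1 (horner_mx (V z))).
rewrite rmorphM /= Cayley_Hamilton mulr0 rmorphB rmorphXn /= horner_mx_X.
by rewrite horner_mx_C => /eqP; rewrite subr_eq0 => /eqP.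
Qed.

Lemma symm_mx_scalar n (c : E) : symm_mx n (c%:M : 'M_2) = (c ^+ n)%:M.
Proof.
apply/matrixP => i k.
rewrite !mxE /= !mulr0n !mulr1n !polyC0 !mul0r addr0 add0r.
rewrite exprMn -polyC_exp mulrA -polyC_exp -polyCM -exprD subnK ?leq_ord //.
by rewrite coefCM coefXn eq_sym mulr_natr.
Qed.

Lemma reduction_mx_scalar (J : finType) (sigma : J -> {rmorphism F -> E})
    n m z :
  z \in Z -> exists c, reduction_mx sigma n m z = c%:M.
Proof.
move=> /GL2_centerP[c zc].
pose d s := \det (map_mx (sigma s) (GLval z)) ^ m s * sigma s c ^+ n s.
exists (\prod_s d s); apply/matrixP => a b; rewrite !mxE.
under eq_bigr => s _ do
  rewrite {2}zc map_scalar_mx symm_mx_scalar scale_scalar_mx mxE -/(d s).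
have [->|neq_ab] := eqVneq a b.
  by rewrite mulr1n; apply: eq_bigr => s _; rewrite eqxx.
have [s neq_s] : exists s,
    (enum_val a : alg_basis n) s != (enum_val b : alg_basis n) s.
  apply/existsP; apply: contraR neq_ab; rewrite negb_exists => /forallP eq_ab.
  by apply/eqP/enum_val_inj/ffunP => s; apply/eqP; rewrite -[_ == _]negbK eq_ab.
by rewrite mulr0n (bigD1 s) //= (negPf neq_s) mulr0n mul0r.
Qed.

Lemma char_poly_scalar n (c : E) :
  char_poly (c%:M : 'M_n) = ('X - c%:P) ^+ n.
Proof.
rewrite char_poly_trig ?scalar_mx_is_trig //.
under eq_bigr do rewrite mxE eqxx mulr1n.
by rewrite prodr_const card_ord.
Qed.

Lemma tprodZ m1 n1 m2 n2 (a b : E) (A : 'M_(m1, n1)) (B : 'M_(m2, n2)) :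
  tprod (a *: A) (b *: B) = (a * b) *: tprod A B.
Proof.
elim: m1 A => [|m1 IHm] A /=; first by rewrite scaler0.
rewrite scale_col_mx; congr col_mx; last by rewrite linearZ IHm.
have -> : @usubmx _ 1 m1 n1 (a *: A) = a *: @usubmx _ 1 m1 n1 A.
  by apply/matrixP => i k; rewrite !mxE.
rewrite -!trowbE linearZ /= !trowbE.
by rewrite linearZ /= scalerA.
Qed.

Lemma tprod_scalar m n (a b : E) :
  tprod (a%:M : 'M_m) (b%:M : 'M_n) = (a * b)%:M.
Proof. by rewrite -(scalemx1 m a) -(scalemx1 n b) tprodZ tprod1 scalemx1. Qed.

End CentralCharacters.

(** * Central characters of tensor products and periodicity of the error term *)

Section Assembly.

Variables (R : realType) (E : closedFieldType) (F : finFieldType).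
Variable j : {rmorphism F -> E}.
Local Notation G := 'GL_2[F]%G.
Local Notation Z := 'Z('GL_2[F])%g.
Local Notation N := #|G|.

Lemma rep_class_eq0 n (V : mx_representation E G n) :
  n = 0%N -> rep_class R V = 0.
Proof. by move=> n0; move: V; rewrite n0; apply: rep_class_dim0. Qed.

Lemma central_charE n (V : mx_representation E G n) a z :
  has_central_char j V a -> z \in Z -> exists c, V z = (j c)%:M.
Proof. by move=> Va Zz; exists (val (val a (subg Z z))); rewrite -Va subgK. Qed.

Lemma central_charE2 n n' (V : mx_representation E G n)
    (V' : mx_representation E G n') a :
  has_central_char j V a -> has_central_char j V' a ->
  forall z, z \in Z -> exists c, V z = c%:M /\ V' z = c%:M.
Proof.
move=> Va V'a z Zz; exists (j (val (val a (subg Z z)))).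
by rewrite -Va -V'a subgK.
Qed.

Lemma prod_central_char w u (W : mx_representation E G w)
    (U : mx_representation E G u) : (0 < u)%N ->
  (exists a, has_central_char j W a) ->
  (forall z, z \in Z -> exists c, U z = c%:M) ->
  exists a, has_central_char j (prod_repr W U) a.
Proof.
move=> u_gt0 [a Wa] cenU.
case: w => [|w] in W Wa *.
  by exists a => z; rewrite [LHS]flatmx0 [RHS]flatmx0.
apply: central_char_exists => [|z Zz]; first by rewrite muln_gt0.
have [c Wz] := central_charE Wa Zz; have [d Uz] := cenU z Zz.
by exists (j c * d); rewrite -tprod_scalar -Wz -Uz.
Qed.

Variable p : nat.
Hypothesis pE : p \in [pchar E].
Variable chi : nat -> E -> algC.
Hypothesis chi1 : forall t, chi t 1 = 1.
Hypothesis chiM : forall t x y, x ^+ N = 1 -> y ^+ N = 1 ->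
  chi t (x * y) = chi t x * chi t y.
Hypothesis chi_sep : forall s1 s2, (forall x, x \in s1 ++ s2 -> x ^+ N = 1) ->
  (forall t, \sum_(x <- s1) chi t x = \sum_(x <- s2) chi t x) -> perm_eq s1 s2.

Lemma expr_mod (C : fieldType) (x : C) (m m' : int) : x ^+ N = 1 -> x != 0 ->
  (m %% N)%Z = (m' %% N)%Z -> x ^ m = x ^ m'.
Proof.
move=> xN x0 eq_m; rewrite (divz_eq m N) (divz_eq m' N) eq_m !expfzDr //.
congr (_ * _).
by rewrite ![(_ * (N : int))%R]mulrC -!exprz_exp -!exprnP xN !exp1rz.
Qed.

(** Where chi(a) and chi(b) differ for [j], the eigenvalues under every [sigma s] are also
    separated, by [chi_ratio]; so each factor of the Brauer character of [U] is periodic in [n s]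
    and [m s]. *)
Lemma reduction_congruent (J : finType) (sigma : J -> {rmorphism F -> E})
    (n n' : J -> nat) (m m' : J -> int) w (W : mx_representation E G w)
    u (U : mx_representation E G u) u' (U' : mx_representation E G u') :
  (forall s, n s = n' s %[mod N]) -> (forall s, (m s %% N)%Z = (m' s %% N)%Z) ->
  (forall g, char_poly (U g) = char_poly (reduction_mx sigma n m g)) ->
  (forall g, char_poly (U' g) = char_poly (reduction_mx sigma n' m' g)) ->
  N%:R *: rep_class R (prod_repr W U) - sym_defect R j (prod_repr W U) =
  N%:R *: rep_class R (prod_repr W U') - sym_defect R j (prod_repr W U').
Proof.
move=> eq_n eq_m cpU cpU'.
apply: (sym_defect_congruent R pE chi1 chiM chi_sep) => t g a b eig_ab neq_chi.
rewrite !(brauer_sum_prod chiM); congr (_ * _).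
have ab_ s : {ab : E * E | eigs (std_repr (sigma s) g) = [:: ab.1; ab.2]}.
  apply: cid; have [a' [b' [? _ _]]] := std_eigs (sigma s) g.
  by exists (a', b').
pose a' s := (sval (ab_ s)).1; pose b' s := (sval (ab_ s)).2.
have eig_ab' s : eigs (std_repr (sigma s) g) = [:: a' s; b' s].
  by rewrite /a' /b'; case: (ab_ s).
(* [U] and [U'] are known only through their characteristic polynomials, which is all that [eigs]
   reads. *)
rewrite /brauer_sum /eigs cpU cpU'.
have := brauer_sum_reduction chi1 chiM; rewrite /brauer_sum /eigs => bs.
rewrite !(bs _ _ _ _ _ _ _ _ eig_ab'); apply: eq_bigr => s _.
have aN : a' s ^+ N = 1.
  by apply: (@std_eig_torsion _ _ (sigma s) g); rewrite eig_ab' mem_head.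
have bN : b' s ^+ N = 1.
  by apply: (@std_eig_torsion _ _ (sigma s) g); rewrite eig_ab' !inE eqxx orbT.
have detN : \det (std_repr (sigma s) g) ^+ N = 1.
  have [x [y [eig_xy ->]]] := eigs2 (std_repr (sigma s) g).
  by move: eig_xy; rewrite eig_ab' => -[<- <-]; apply: torsionM.
congr (_ * _).
  have chiN := chi_torsion chi1 chiM t detN.
  exact: expr_mod chiN (chi_neq0 chi1 chiM t detN) (eq_m s).
apply: homog_sum_mod (eq_n s); try exact: chi_torsion.
by apply: contra_neq neq_chi => /(chi_ratio pE chi1 chiM eig_ab (eig_ab' s)).
Qed.

End Assembly.

Theorem theorem1p1 (R : realType) (p : nat) (p_prime : prime p)
    (Qp : fieldType) (v : Qp -> R) (Qp_padic : is_padic_field p v)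
    (K : fieldExtType Qp) (h : nat) (degK : \dim {: K} = h)
    (F : finFieldType) (redK : K -> F)
    (redKP : is_residue_map (int_ring v (in_alg K)) redK)
    (Qpbar : closedFieldType) (iota : {rmorphism Qp -> Qpbar})
    (Qpbar_alg : forall x, algebraicOver iota x)
    (E : closedFieldType) (j : {rmorphism F -> E})
    (E_alg : forall x, algebraicOver j x)
    (redE : Qpbar -> E) (redEP : is_residue_map (int_ring v iota) redE)
    (J : finType) (tau : J -> {rmorphism K -> Qpbar})
    (tauP : enumerates_embeddings iota tau) :
  exists S : central_char F -> rep_group R E 'GL_2[F],
  forall (N : rep_group R E 'GL_2[F] -> R), is_norm N ->
  forall (w : nat) (W : mx_representation E 'GL_2[F] w),
    (exists a, has_central_char j W a) ->
  exists C : R,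
  forall (n : J -> nat) (m : J -> int)
         (u : nat) (U : mx_representation E 'GL_2[F] u),
    is_reduction (int_ring v (in_alg K)) redK (int_ring v iota) redE R
      (alg_repr tau n m) U ->
    (exists a, has_central_char j (prod_repr W U) a) /\
    (forall a, has_central_char j (prod_repr W U) a ->
       N (rep_class R (prod_repr W U) - (w * u)%:R *: S a)
         <= C * u%:R `^ (1 - h%:R^-1)).
Proof.
have [p' _ pF] := finPcharP F.
have pE : p' \in [pchar E] by rewrite (fmorph_pchar j).
set N0 := #|'GL_2[F]%g|; have N_gt0 : (0 < N0)%N := cardG_gt0 _.
have [chi [chi1 chiM chi_sep]] := brauer_lift pE N_gt0.
have [tau_iota _ _] := tauP.
have sigma_ex s := cid (@residue_embedding _ _ _ _ Qp_padic _ _ _ _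
  (in_alg K) iota  (tau s) redK redE (tau_iota s) redKP redEP).
pose sigma s := sval (sigma_ex s).
have sigmaP s x : int_ring v (in_alg K) x -> redE (tau s x) = sigma s (redK x).
  exact: (svalP (sigma_ex s)).
pose central a (V : repr_obj E 'GL_2[F]) :=
  (0 < projT1 V)%N /\ has_central_char j (projT2 V) a.
(* Any nonzero representation with central character [a] may serve, as [SE] shows; the default is
   0. *)
pose S a : rep_group R E 'GL_2[F] :=
  if pselect (exists V, central a V) is left H then
    let V := sval (cid H) in
    (N0 * projT1 V)%:R^-1 *: sym_defect R j (projT2 V)
  else 0.
have SE n (V : mx_representation E 'GL_2[F] n) a : has_central_char j V a ->
    n%:R *: S a = N0%:R^-1 *: sym_defect R j V.
  have [n0 _ | n_gt0 Va] := posnP n.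
    rewrite /sym_defect !rep_class_eq0 ?n0 ?muln0 //.
    by rewrite scale0r subrr scaler0.
  rewrite /S; case: pselect => [H | []]; last by exists (existT _ n V).
  case: (cid H) => -[k X] /= [k_gt0 Xa].
  have := sym_defect_central R j pE chi1 chiM chi_sep (central_charE2 Xa Va).
  move=> /(congr1 (fun x => (N0 * k)%:R^-1 *: x)); rewrite !scalerA mulrC => ->.
  by rewrite natrM invfM -mulrA mulVf ?mulr1 // pnatr_eq0 -lt0n.
exists S => nu _ w W Wa.
pose resn (n : J -> nat) : {ffun J -> 'I_N0} :=
  [ffun s => Ordinal (ltn_pmod (n s) N_gt0)].
have resm_lt (a : int) : (`|(a %% N0)%Z| < N0)%N.
  rewrite -ltz_nat gez0_abs ?modz_ge0 -?lt0n //.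
  by rewrite ltz_pmod.
pose resm (m : J -> int) : {ffun J -> 'I_N0} :=
  [ffun s => Ordinal (resm_lt (m s))].
pose Y u (U : mx_representation E 'GL_2[F] u) :=
  N0%:R *: rep_class R (prod_repr W U) - sym_defect R j (prod_repr W U).
(* The error, multiplied by [N0], depends only on the residues [r] of n and m; [Yr] chooses its
   value for each of the finitely many [r]. *)
pose isY (r : {ffun J -> 'I_N0} * {ffun J -> 'I_N0}) y :=
  exists n m u (U : mx_representation E 'GL_2[F] u),
  [/\ (resn n, resm m) = r, is_reduction (int_ring v (in_alg K)) redK
      (int_ring v iota) redE R (alg_repr tau n m) U & y = Y u U].
pose Yr r := if pselect (exists y, isY r y) is left H then sval (cid H) else 0.
(* The constant dominates all the values of the error at once; absolute values make every term
   nonnegative. *)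
exists (\sum_r `|nu (N0%:R^-1 *: Yr r)|) => n m u U redU.
have [def_u cpU] :=
  reduction_char_poly Qp_padic redKP redEP tau_iota sigmaP redU.
have u_gt0 : (0 < u)%N.
  by rewrite def_u; apply/card_gt0P; exists [ffun s => ord0].
split.
  apply: prod_central_char Wa _ => // z Zz.
  have [c red_c] := reduction_mx_scalar sigma n m Zz.
  apply: (central_scalar j Zz (c := c)).
  by rewrite cpU red_c char_poly_scalar -def_u.
move=> a Va.
have -> : rep_class R (prod_repr W U) - (w * u)%:R *: S a =
    N0%:R^-1 *: Y u U.
  rewrite (SE _ _ _ Va) /Y [RHS]scalerBr [in RHS]scalerA mulVf ?scale1r //.
  by rewrite pnatr_eq0 -lt0n.
have -> : Y u U = Yr (resn n, resm m).
  rewrite /Yr; case: pselect => [H | []]; last first.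
    by exists (Y u U), n, m, u, U.
  have [n' [m' [u' [U' [[eq_n eq_m] redU' ->]]]]] := svalP (cid H).
  have [_ cpU'] :=
    reduction_char_poly Qp_padic redKP redEP tau_iota sigmaP redU'.
  apply: (reduction_congruent R j pE chi1 chiM chi_sep W _ _ cpU cpU') => s.
    by have /ffunP/(_ s) := eq_n; rewrite !ffunE => /(congr1 val).
  have /ffunP/(_ s) := eq_m; rewrite !ffunE => /(congr1 val) /= eq_ms.
  rewrite -[LHS]gez0_abs ?modz_ge0 -?lt0n //.
  by rewrite -[RHS]gez0_abs ?modz_ge0 -?lt0n // eq_ms.
set y := nu _; apply: (@le_trans _ _ `|y|); first exact: ler_norm.
have le_y : `|y| <= \sum_r `|nu (N0%:R^-1 *: Yr r)|.
  by rewrite (bigD1 (resn n, resm m)) //= lerDl sumr_ge0.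
apply: le_trans le_y _; rewrite ler_peMr ?sumr_ge0 //.
(* A constant bound suffices: u >= 1 and the exponent 1 - 1/h is nonnegative, so the power of u is
   at least 1. *)
have u_ge1 : 1 <= u%:R :> R by rewrite ler1n.
have := @ler_powR _ _ u_ge1 0 (1 - h%:R^-1); rewrite powRr0; apply.
have h_gt0 : (0 < h)%N by rewrite -degK adim_gt0.
by rewrite subr_ge0 invf_le1 ?ltr0n // ler1n.
Qed.
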